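(* Let $Q$ be a Dynkin quiver with underlying graph $\Delta$. Then $\delta_\sigma=\delta_{B,A\oplus C}$ for any triangle $\sigma\colon A\to B\to C\to A[1]$ in $\mathcal{D}^b(Q)$.
   Context: $\Bbbk$ is an algebraically closed field. $\Delta$ is a Dynkin graph of type $\mathbb{A}_n$ ($n\ge1$), $\mathbb{D}_n$ ($n\ge4$), $\mathbb{E}_6,\mathbb{E}_7$ or $\mathbb{E}_8$ with vertex set $\Delta_0$; $\mathrm{dist}$ is the graph distance. $Q$ is a quiver with underlying graph $\Delta$, $\mathcal{D}^b(Q)$ the bounded derived category of finite dimensional representations of $Q$ over $\Bbbk$; $\mathbf{dim}\,X\in\mathbb{Z}^{Q_0}\cong K_0(\mathcal{D}^b(Q))$ is the class of $X$. $[X,Y]^i=\dim_\Bbbk\mathrm{Hom}_{\mathcal{D}^b(Q)}(X,Y[i])$ and $\langle X,Y\rangle=\sum_{i\le0}(-1)^i[X,Y]^i$. Call $(p,a),(q,b)\in\mathbb{Z}\times\Delta_0$ equivalent if $(q-p)+\mathrm{dist}(a,b)$ is even; the two classes are $(\mathbb{Z}\times\Delta_0)^{\mathbf v}$ (the one containing $(0,x_0)$ for a chosen base vertex $x_0$) and $(\mathbb{Z}\times\Delta_0)^{\mathbf m}$. The quiver $\mathbb{Z}\Delta$ has vertices $\mathbf{v}_{p,a}$, $(p,a)\in(\mathbb{Z}\times\Delta_0)^{\mathbf v}$, and an arrow $\mathbf{v}_{p,a}\to\mathbf{v}_{q,b}$ iff $a,b$ are adjacent and $q=p+1$. For $(p,a)\in(\mathbb{Z}\times\Delta_0)^{\mathbf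 m}$ the mesh $\mathbf{m}_{p,a}$ is the subquiver formed by all paths of length two from $\mathbf{v}_{p-1,a}$ to $\mathbf{v}_{p+1,a}$; $(\mathbb{Z}\Delta)_2$ is the set of meshes. The category of indecomposable objects of $\mathcal{D}^b(Q)$ is equivalent to the mesh category of $\mathbb{Z}\Delta$ (path category modulo, for each mesh, the sum of the paths of length two in it), and the $\mathbf{v}_{p,a}$ are accordingly identified with a complete set of pairwise non-isomorphic indecomposable objects of $\mathcal{D}^b(Q)$, with Auslander–Reiten translation $\tau\mathbf{v}_{p,a}=\mathbf{v}_{p-2,a}$. For a triangle $\sigma:A\to B\to C\xrightarrow{\gamma}A[1]$, $\delta_\sigma:(\mathbb{Z}\Delta)_2\to\mathbb{Z}$ is $\delta_\sigma(\mathbf{m}_{p,a})=\mathrm{rk}\,\mathrm{Hom}_{\mathcal{D}^b(Q)}(\mathbf{v}_{p+1,a},\gamma)=\mathrm{rk}\,\mathrm{Hom}_{\mathcal{D}^b(Q)}(\gamma[-1],\mathbf{v}_{p-1,a})$. For $M,N\in\mathcal{D}^b(Q)$ with $\mathbf{dim}\,M=\mathbf{dim}\,N$, $\delta_{M,N}:(\mathbb{Z}\Delta)_2\to\mathbb{Z}$ is $\delta_{M,N}(\mathbf{m}_{p,a})=\langle\mathbf{v}_{p+1,a},N\rangle-\langle\mathbf{v}_{p+1,a},M\rangle=\langle N,\mathbf{v}_{p-1,a}\rangle-\langle M,\mathbf{v}_{p-1,a}\rangle$. *)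

(* Defs.v *)
From HB Require Import structures.
From mathcomp Require Import all_boot all_order all_algebra generic_quotient.
From mathcomp Require Import boolp classical_sets functions cardinality fsbigop.
From mathcomp Require Import zify.

Set Implicit Arguments.
Unset Strict Implicit.
Unset Printing Implicit Defensive.

Import GRing.Theory Num.Theory.
Local Open Scope ring_scope.

(** Hom spaces are bare [lmodType]s, without a built-in dimension.  [sdim] is
    [0] on subspaces that are not finite dimensional. *)

Section Dimension.
Variables (k : fieldType) (V : lmodType k).

Definition basis_of_set (A : set V) (n : nat) (e : 'I_n -> V) : Prop :=
  (forall c : 'I_n -> k, \sum_i c i *: e i = 0 -> forall i, c i = 0) /\
  A = [set x | exists c : 'I_n -> k, x = \sum_i c i *: e i]%classic.

Definition sdim (A : set V) : nat :=
  xget 0%N [set n | exists e : 'I_n -> V, basis_of_set A e]%classic.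

End Dimension.

Definition ldim (k : fieldType) (V : lmodType k) : nat := sdim [set: V]%classic.

Definition rk (k : fieldType) (V W : lmodType k) (f : V -> W) : nat :=
  sdim (range f).

Record lincat (k : fieldType) := LinCat {
  ob :> Type;
  mor : ob -> ob -> lmodType k;
  idm : forall X, mor X X;
  mcomp : forall X Y Z, mor Y Z -> mor X Y -> mor X Z;
  comp_linl : forall X Y Z (c : k) (g g' : mor Y Z) (f : mor X Y),
    mcomp (c *: g + g') f = c *: mcomp g f + mcomp g' f;
  comp_linr : forall X Y Z (c : k) (g : mor Y Z) (f f' : mor X Y),
    mcomp g (c *: f + f') = c *: mcomp g f + mcomp g f';
  comp_assoc : forall X Y Z T (h : mor Z T) (g : mor Y Z) (f : mor X Y),
    mcomp h (mcomp g f) = mcomp (mcomp h g) f;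
  comp_idl : forall X Y (f : mor X Y), mcomp (idm Y) f = f;
  comp_idr : forall X Y (f : mor X Y), mcomp f (idm X) = f
}.

Arguments mor {k l}.
Arguments idm {k l}.
Arguments mcomp {k l X Y Z}.
Notation "g '∘' f" := (mcomp g f) (at level 40, left associativity).

Section CategoryNotions.
Variables (k : fieldType) (C : lincat k).
Implicit Types X Y Z : C.

Definition is_iso X Y (f : mor X Y) : Prop :=
  exists g : mor Y X, g ∘ f = idm X /\ f ∘ g = idm Y.

Definition isomorphic X Y : Prop := exists f : mor X Y, is_iso f.

Definition is_retraction X Y (f : mor X Y) : Prop :=
  exists s : mor Y X, f ∘ s = idm Y.

Definition is_zero_ob X : Prop := idm X = 0.

Definition is_direct_sum X Y Z : Prop :=
  exists (i1 : mor Y X) (i2 : mor Z X) (p1 : mor X Y) (p2 : mor X Z),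
    [/\ p1 ∘ i1 = idm Y, p2 ∘ i2 = idm Z & i1 ∘ p1 + i2 ∘ p2 = idm X].

Definition indecomposable X : Prop :=
  ~ is_zero_ob X /\
  forall Y Z, is_direct_sum X Y Z -> is_zero_ob Y \/ is_zero_ob Z.

End CategoryNotions.

Record linfunctor (k : fieldType) (C D : lincat k) := LinFunctor {
  fob :> C -> D;
  fmor : forall X Y, mor X Y -> mor (fob X) (fob Y);
  fmor_lin : forall X Y (c : k) (f g : mor X Y),
    fmor (c *: f + g) = c *: fmor f + fmor g;
  fmor_id : forall X, fmor (idm X) = idm (fob X);
  fmor_comp : forall X Y Z (g : mor Y Z) (f : mor X Y),
    fmor (g ∘ f) = fmor g ∘ fmor f
}.

Definition fully_faithful (k : fieldType) (C D : lincat k)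
    (F : linfunctor C D) : Prop :=
  forall X Y, bijective (@fmor _ _ _ F X Y).

(** Linear categories presented by generators and relations: morphisms are
    formal expressions in the generators, modulo the smallest congruence that
    contains the relations and the axioms of a [k]-linear category.  Path
    categories modulo relations, and localizations, are of this form. *)

Section Expressions.
Variables (k : fieldType) (O : Type) (gen : O -> O -> Type).

Inductive expr : O -> O -> Type :=
| EGen X Y : gen X Y -> expr X Y
| EId X : expr X X
| EComp X Y Z : expr Y Z -> expr X Y -> expr X Z
| EZero X Y : expr X Y
| EAdd X Y : expr X Y -> expr X Y -> expr X Y
| EScale X Y : k -> expr X Y -> expr X Y.

Definition relations := forall X Y, expr X Y -> expr X Y -> Prop.

Inductive econgr (rels : relations) :
    forall X Y, expr X Y -> expr X Y -> Prop :=
| congr_rel X Y (f g : expr X Y) : rels X Y f g -> econgr rels f g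
| congr_refl X Y (f : expr X Y) : econgr rels f f
| congr_sym X Y (f g : expr X Y) : econgr rels f g -> econgr rels g f
| congr_trans X Y (f g h : expr X Y) :
    econgr rels f g -> econgr rels g h -> econgr rels f h
| congr_comp X Y Z (g g' : expr Y Z) (f f' : expr X Y) :
    econgr rels g g' -> econgr rels f f' ->
    econgr rels (EComp g f) (EComp g' f')
| congr_add X Y (f f' g g' : expr X Y) :
    econgr rels f f' -> econgr rels g g' -> econgr rels (EAdd f g) (EAdd f' g')
| congr_scale X Y (c : k) (f f' : expr X Y) :
    econgr rels f f' -> econgr rels (EScale c f) (EScale c f')
| congr_addA X Y (f g h : expr X Y) :
    econgr rels (EAdd f (EAdd g h)) (EAdd (EAdd f g) h)
| congr_addC X Y (f g : expr X Y) : econgr rels (EAdd f g) (EAdd g f)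
| congr_add0 X Y (f : expr X Y) : econgr rels (EAdd (EZero X Y) f) f
| congr_addN X Y (f : expr X Y) :
    econgr rels (EAdd (EScale (-1) f) f) (EZero X Y)
| congr_scaleA X Y (c d : k) (f : expr X Y) :
    econgr rels (EScale c (EScale d f)) (EScale (c * d) f)
| congr_scale1 X Y (f : expr X Y) : econgr rels (EScale 1 f) f
| congr_scaleDr X Y (c : k) (f g : expr X Y) :
    econgr rels (EScale c (EAdd f g)) (EAdd (EScale c f) (EScale c g))
| congr_scaleDl X Y (c d : k) (f : expr X Y) :
    econgr rels (EScale (c + d) f) (EAdd (EScale c f) (EScale d f))
| congr_compA X Y Z T (h : expr Z T) (g : expr Y Z) (f : expr X Y) :
    econgr rels (EComp h (EComp g f)) (EComp (EComp h g) f)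
| congr_id_l X Y (f : expr X Y) : econgr rels (EComp (EId Y) f) f
| congr_id_r X Y (f : expr X Y) : econgr rels (EComp f (EId X)) f
| congr_lin_l X Y Z (c : k) (g g' : expr Y Z) (f : expr X Y) :
    econgr rels (EComp (EAdd (EScale c g) g') f)
              (EAdd (EScale c (EComp g f)) (EComp g' f))
| congr_lin_r X Y Z (c : k) (g : expr Y Z) (f f' : expr X Y) :
    econgr rels (EComp g (EAdd (EScale c f) f'))
              (EAdd (EScale c (EComp g f)) (EComp g f')).

End Expressions.

Arguments EId {k O gen X}.
Arguments EZero {k O gen X Y}.
Arguments EGen {k O gen X Y}.

HB.instance Definition _ (k : fieldType) (O : Type) (gen : O -> O -> Type)
  (X Y : O) := gen_eqMixin (expr k gen X Y).
HB.instance Definition _ (k : fieldType) (O : Type) (gen : O -> O -> Type)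
  (X Y : O) := gen_choiceMixin (expr k gen X Y).

Section Presented.
Variables (k : fieldType) (O : Type) (gen : O -> O -> Type).
Variable rels : relations k gen.
Local Open Scope quotient_scope.

Section HomSpace.
Variables X Y : O.

Definition congrb : rel (expr k gen X Y) := fun f g => `[< econgr rels f g >].

Fact congrb_equiv : equiv_class_of congrb.
Proof.
split=> [f|f g|g f h].
- by apply/asboolP; apply: congr_refl.
- by apply/asboolP/asboolP => H; apply: congr_sym.
- by move=> /asboolP fg /asboolP gh; apply/asboolP; apply: congr_trans fg gh.
Qed.

Canonical congrb_equiv_rel := EquivRelPack congrb_equiv.

Definition phom := {eq_quot congrb}.
HB.instance Definition _ := Choice.on phom.

Definition pclass (f : expr k gen X Y) : phom := \pi_phom f.

Lemma pclassP (f g : expr k gen X Y) : econgr rels f g <-> pclass f = pclass g.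
Proof.
split=> [fg|/eqmodP/asboolP//].
by apply/eqmodP/asboolP.
Qed.

Lemma pclassK (q : phom) : pclass (repr q) = q.
Proof. exact: reprK. Qed.

Lemma congr_repr (f : expr k gen X Y) : econgr rels (repr (pclass f)) f.
Proof. by apply/pclassP; rewrite pclassK. Qed.

Definition phom_add (f g : phom) := pclass (EAdd (repr f) (repr g)).
Definition phom_scale (c : k) (f : phom) := pclass (EScale c (repr f)).
Definition phom_opp (f : phom) := phom_scale (-1) f.
Definition phom_zero := pclass EZero.

Lemma phom_addE f g : phom_add (pclass f) (pclass g) = pclass (EAdd f g).
Proof. by apply/pclassP; apply: congr_add; apply: congr_repr. Qed.

Lemma phom_scaleE c f : phom_scale c (pclass f) = pclass (EScale c f).
Proof. by apply/pclassP; apply: congr_scale; apply: congr_repr. Qed.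

Fact phom_addA : associative phom_add.
Proof.
move=> f g h; rewrite -(pclassK f) -(pclassK g) -(pclassK h) !phom_addE.
by apply/pclassP; apply: congr_addA.
Qed.

Fact phom_addC : commutative phom_add.
Proof.
move=> f g; rewrite -(pclassK f) -(pclassK g) !phom_addE.
by apply/pclassP; apply: congr_addC.
Qed.

Fact phom_add0 : left_id phom_zero phom_add.
Proof.
move=> f; rewrite -(pclassK f) phom_addE.
by apply/pclassP; apply: congr_add0.
Qed.

Fact phom_addN : left_inverse phom_zero phom_opp phom_add.
Proof.
move=> f; rewrite -(pclassK f) /phom_opp phom_scaleE phom_addE.
by apply/pclassP; apply: congr_addN.
Qed.

HB.instance Definition _ := GRing.isZmodule.Build phom
  phom_addA phom_addC phom_add0 phom_addN.

Lemma pclassD f g : pclass (EAdd f g) = pclass f + pclass g.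
Proof. by rewrite -phom_addE. Qed.

Fact phom_scaleA c d f : phom_scale c (phom_scale d f) = phom_scale (c * d) f.
Proof.
rewrite -(pclassK f) !phom_scaleE.
by apply/pclassP; apply: congr_scaleA.
Qed.

Fact phom_scale1 : left_id 1 phom_scale.
Proof.
move=> f; rewrite -(pclassK f) phom_scaleE.
by apply/pclassP; apply: congr_scale1.
Qed.

Fact phom_scaleDr : right_distributive phom_scale +%R.
Proof.
move=> c f g; rewrite -(pclassK f) -(pclassK g) -pclassD !phom_scaleE -pclassD.
by apply/pclassP; apply: congr_scaleDr.
Qed.

Fact phom_scaleDl f : {morph phom_scale^~ f : c d / c + d}.
Proof.
move=> c d; rewrite -(pclassK f) !phom_scaleE -pclassD.
by apply/pclassP; apply: congr_scaleDl.
Qed.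

HB.instance Definition _ := GRing.Zmodule_isLmodule.Build k phom
  phom_scaleA phom_scale1 phom_scaleDr phom_scaleDl.

Lemma pclassZ c f : pclass (EScale c f) = c *: pclass f.
Proof. by rewrite -phom_scaleE. Qed.

Lemma pclass0 : pclass EZero = 0.
Proof. by []. Qed.

End HomSpace.

Definition pcomp X Y Z (g : phom Y Z) (f : phom X Y) : phom X Z :=
  pclass (EComp (repr g) (repr f)).

Lemma pcompE X Y Z (g : expr k gen Y Z) (f : expr k gen X Y) :
  pcomp (pclass g) (pclass f) = pclass (EComp g f).
Proof. by apply/pclassP; apply: congr_comp; apply: congr_repr. Qed.

Fact pcomp_linl X Y Z (c : k) (g g' : phom Y Z) (f : phom X Y) :
  pcomp (c *: g + g') f = c *: pcomp g f + pcomp g' f.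
Proof.
rewrite -(pclassK f) -(pclassK g) -(pclassK g') -pclassZ -pclassD !pcompE.
by rewrite -pclassZ -pclassD; apply/pclassP; apply: congr_lin_l.
Qed.

Fact pcomp_linr X Y Z (c : k) (g : phom Y Z) (f f' : phom X Y) :
  pcomp g (c *: f + f') = c *: pcomp g f + pcomp g f'.
Proof.
rewrite -(pclassK f) -(pclassK g) -(pclassK f') -pclassZ -pclassD !pcompE.
by rewrite -pclassZ -pclassD; apply/pclassP; apply: congr_lin_r.
Qed.

Fact pcomp_assoc X Y Z T (h : phom Z T) (g : phom Y Z) (f : phom X Y) :
  pcomp h (pcomp g f) = pcomp (pcomp h g) f.
Proof.
rewrite -(pclassK f) -(pclassK g) -(pclassK h) !pcompE.
by apply/pclassP; apply: congr_compA.
Qed.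

Fact pcomp_idl X Y (f : phom X Y) : pcomp (pclass EId) f = f.
Proof.
by rewrite -(pclassK f) pcompE; apply/pclassP; apply: congr_id_l.
Qed.

Fact pcomp_idr X Y (f : phom X Y) : pcomp f (pclass EId) = f.
Proof.
by rewrite -(pclassK f) pcompE; apply/pclassP; apply: congr_id_r.
Qed.

Definition presented : lincat k :=
  LinCat pcomp_linl pcomp_linr pcomp_assoc pcomp_idl pcomp_idr.

Section Extension.
Variables (C : lincat k) (F0 : O -> C).
Variable F1 : forall X Y, gen X Y -> mor (F0 X) (F0 Y).

Fixpoint eval X Y (f : expr k gen X Y) : mor (F0 X) (F0 Y) :=
  match f with
  | EGen _ _ g => F1 g
  | EId _ => idm _
  | EComp _ _ _ g h => eval g ∘ eval h
  | EZero _ _ => 0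
  | EAdd _ _ g h => eval g + eval h
  | EScale _ _ c g => c *: eval g
  end.

Hypothesis F1_rel : forall X Y (f g : expr k gen X Y),
  rels f g -> eval f = eval g.

Lemma eval_congr X Y (f g : expr k gen X Y) :
  econgr rels f g -> eval f = eval g.
Proof.
elim=> //=.
- by move=> *; congruence.
- by move=> ? ? ? ? ? ? ? _ -> _ ->.
- by move=> ? ? ? ? ? ? _ -> _ ->.
- by move=> ? ? ? ? ? _ ->.
- by move=> *; rewrite addrA.
- by move=> *; rewrite addrC.
- by move=> *; rewrite add0r.
- by move=> *; rewrite scaleN1r addNr.
- by move=> *; rewrite scalerA.
- by move=> *; rewrite scale1r.
- by move=> *; rewrite scalerDr.
- by move=> *; rewrite scalerDl.
- by move=> *; rewrite comp_assoc.
- by move=> *; rewrite comp_idl.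
- by move=> *; rewrite comp_idr.
- by move=> *; rewrite comp_linl.
- by move=> *; rewrite comp_linr.
Qed.

Definition ext_mor (X Y : presented) (f : mor X Y) : mor (F0 X) (F0 Y) :=
  eval (repr (f : phom X Y)).

Lemma ext_morE X Y (f : expr k gen X Y) : ext_mor (pclass f) = eval f.
Proof. by apply: eval_congr; apply: congr_repr. Qed.

Fact ext_mor_lin (X Y : presented) (c : k) (f g : mor X Y) :
  ext_mor (c *: f + g) = c *: ext_mor f + ext_mor g.
Proof.
by rewrite -[f]pclassK -[g]pclassK -pclassZ -pclassD !ext_morE.
Qed.

Fact ext_mor_id (X : presented) : ext_mor (idm X) = idm (F0 X).
Proof. by rewrite ext_morE. Qed.

Fact ext_mor_comp (X Y Z : presented) (g : mor Y Z) (f : mor X Y) :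
  ext_mor (g ∘ f) = ext_mor g ∘ ext_mor f.
Proof. by rewrite -[f]pclassK -[g]pclassK /= pcompE !ext_morE. Qed.

Definition extension : linfunctor presented C :=
  LinFunctor ext_mor_lin ext_mor_id ext_mor_comp.

End Extension.

End Presented.

Definition chain_graph n : rel 'I_n := fun i j => (i.+1 == j) || (j.+1 == i).

(** The chain [0 - 1 - ... - (n-2)] with the vertex [n-1] attached to [c]. *)
Definition branched_graph n (c : nat) : rel 'I_n := fun i j =>
  let edge (x y : nat) :=
    ((x.+1 == y) && (y < n.-1)%N) || ((x == c) && (y == n.-1)) in
  edge i j || edge j i.

Variant dynkin_model : forall n, rel 'I_n -> Prop :=
| DynkinA n : (1 <= n)%N -> dynkin_model (@chain_graph n)
| DynkinD n : (4 <= n)%N -> dynkin_model (@branched_graph n (n - 3)%N)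
| DynkinE n : (6 <= n <= 8)%N -> dynkin_model (@branched_graph n 2%N).

Definition is_dynkin (D0 : finType) (adj : rel D0) : Prop :=
  exists n (r : rel 'I_n) (f : D0 -> 'I_n),
    [/\ dynkin_model r, bijective f & forall a b, adj a b = r (f a) (f b)].

(** Shortest walks in a connected graph visit no vertex twice, so their lengths
    are less than the number of vertices. *)
Definition gdist (D0 : finType) (adj : rel D0) (a b : D0) : nat :=
  find (fun n => [exists p : n.-tuple D0, path adj a p && (last a p == b)])
       (iota 0 #|D0|).

Record quiver (Q0 : finType) := Quiver {
  arrow : finType;
  src : arrow -> Q0;
  tgt : arrow -> Q0
}.

Definition has_underlying_graph (Q0 : finType) (Q : quiver Q0) (adj : rel Q0) :
    Prop :=
  (forall e : arrow Q, adj (src e) (tgt e)) /\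
  (forall a b, adj a b -> exists! e : arrow Q,
     (src e = a /\ tgt e = b) \/ (src e = b /\ tgt e = a)).

Section Representations.
Variables (k : fieldType) (Q0 : finType) (Q : quiver Q0).

(** Finite dimensional representations on the coordinate spaces [k ^ n], with
    matrices acting on row vectors.  Every finite dimensional representation is
    isomorphic to one of these; having a small type of objects is what allows
    the Hom spaces of the localization below to live in the universe of the
    [lmodType]s. *)
Record rep := Rep {
  rdim :> Q0 -> nat;
  rmap : forall e : arrow Q, 'M[k]_(rdim (src e), rdim (tgt e))
}.

Record rhom (V W : rep) := RHom {
  rh :> forall a, 'M[k]_(V a, W a);
  rhP : forall e : arrow Q,
    rmap V e *m rh (tgt e) = rh (src e) *m rmap W e
}.

(** Bounded cochain complexes of representations.  The differential is given in
    all bidegrees and vanishes outside of the bidegrees [(i, i + 1)]: this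
    avoids transports along equalities of degrees. *)
Record complex := Complex {
  cx :> int -> rep;
  cd : forall i j, rhom (cx i) (cx j);
  cd_shape : forall i j, j <> i + 1 -> forall a, cd i j a = 0;
  cdd : forall i j l a, cd i j a *m cd j l a = 0;
  cx_bounded : exists N : nat, forall i : int, (N < `|i|)%N ->
    forall a, cx i a = 0%N
}.

Record chmap (X Y : complex) := ChMap {
  ch :> forall i, rhom (X i) (Y i);
  chP : forall i j a, ch i a *m cd Y i j a = cd X i j a *m ch j a
}.

(** [f] is injective, respectively surjective, on all cohomology spaces
    [H^i = ker (d : X^i -> X^j) / im (d : X^h -> X^i)]. *)
Definition quasi_iso (X Y : complex) (f : chmap X Y) : Prop :=
  forall h i j : int, i = h + 1 -> j = i + 1 -> forall a,
    (forall x : 'rV_(X i a), x *m cd X i j a = 0 ->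
       (x *m f i a <= cd Y h i a)%MS -> (x <= cd X h i a)%MS) /\
    (forall y : 'rV_(Y i a), y *m cd Y i j a = 0 ->
       exists x : 'rV_(X i a),
         x *m cd X i j a = 0 /\ (y - x *m f i a <= cd Y h i a)%MS).

(** [Db] below is the bounded derived category, as the localization of the
    category of bounded complexes at the quasi-isomorphisms: morphisms are formal
    expressions in chain maps and inverses of quasi-isomorphisms.  Localizing
    among [k]-linear categories makes no difference, because the localization is
    [k]-linear and so is the localization functor; homotopic chain maps become
    equal in it. *)

Inductive dgen (X Y : complex) : Type :=
| DMap of chmap X Y
| DInv (s : chmap Y X) of quasi_iso s.

Definition emap X Y (f : chmap X Y) : expr k dgen X Y := EGen (DMap f).
Definition einv X Y (s : chmap X Y) (hs : quasi_iso s) : expr k dgen Y X :=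
  EGen (DInv hs).

Inductive drel : relations k dgen :=
| drel_id X (f : chmap X X) :
    (forall i a, f i a = 1%:M) -> drel (emap f) EId
| drel_comp X Y Z (g : chmap Y Z) (f : chmap X Y) (h : chmap X Z) :
    (forall i a, h i a = f i a *m g i a) ->
    drel (emap h) (EComp (emap g) (emap f))
| drel_lin X Y (c : k) (f g h : chmap X Y) :
    (forall i a, h i a = c *: f i a + g i a) ->
    drel (emap h) (EAdd (EScale c (emap f)) (emap g))
| drel_invl X Y (s : chmap X Y) (hs : quasi_iso s) :
    drel (EComp (einv hs) (emap s)) EId
| drel_invr X Y (s : chmap X Y) (hs : quasi_iso s) :
    drel (EComp (emap s) (einv hs)) EId.

Definition Db : lincat k := presented drel.

Definition dmap (X Y : complex) (f : chmap X Y) : @mor k Db X Y :=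
  pclass drel (emap f).

Definition dinv (X Y : complex) (s : chmap X Y) (hs : quasi_iso s) :
  @mor k Db Y X := pclass drel (einv hs).

Lemma dmap_id (X : complex) (f : chmap X X) :
  (forall i a, f i a = 1%:M) -> dmap f = idm (X : Db).
Proof. by move=> fE; apply/pclassP/congr_rel/drel_id. Qed.

Lemma dmap_comp X Y Z (g : chmap Y Z) (f : chmap X Y) (h : chmap X Z) :
  (forall i a, h i a = f i a *m g i a) -> dmap h = dmap g ∘ dmap f.
Proof.
by move=> hE; rewrite /= pcompE; apply/pclassP/congr_rel/drel_comp.
Qed.

Lemma dmap_lin X Y (c : k) (f g h : chmap X Y) :
  (forall i a, h i a = c *: f i a + g i a) -> dmap h = c *: dmap f + dmap g.
Proof.
move=> hE; rewrite /dmap -pclassZ -pclassD.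
by apply/pclassP/congr_rel/drel_lin.
Qed.

Lemma dinvl X Y (s : chmap X Y) (hs : quasi_iso s) :
  dinv hs ∘ dmap s = idm (X : Db).
Proof. by rewrite /= pcompE; apply/pclassP/congr_rel/drel_invl. Qed.

Lemma dinvr X Y (s : chmap X Y) (hs : quasi_iso s) :
  dmap s ∘ dinv hs = idm (Y : Db).
Proof. by rewrite /= pcompE; apply/pclassP/congr_rel/drel_invr. Qed.

Section Shift.
Variable n : int.

Section ShiftComplex.
Variable X : complex.

Definition shift_mx (i j : int) a : 'M_(X (i + n) a, X (j + n) a) :=
  (-1) ^ n *: cd X (i + n) (j + n) a.

Fact shift_rhP (i j : int) (e : arrow Q) :
  rmap (X (i + n)) e *m shift_mx i j (tgt e) =
  shift_mx i j (src e) *m rmap (X (j + n)) e.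
Proof. by rewrite -scalemxAl -scalemxAr rhP. Qed.

Fact shift_shape (i j : int) : j <> i + 1 -> forall a, shift_mx i j a = 0.
Proof. by move=> ij a; rewrite /shift_mx cd_shape ?scaler0//; lia. Qed.

Fact shift_dd (i j l : int) a : shift_mx i j a *m shift_mx j l a = 0.
Proof. by rewrite -scalemxAl -scalemxAr cdd !scaler0. Qed.

Fact shift_bounded : exists N : nat, forall i : int, (N < `|i|)%N ->
  forall a, X (i + n) a = 0%N.
Proof.
have [N XN] := cx_bounded X; exists (N + `|n|)%N => i iN a; apply: XN.
by lia.
Qed.

Definition cshift : complex :=
  @Complex (fun i => X (i + n)) (fun i j => RHom (shift_rhP i j))
    shift_shape shift_dd shift_bounded.

End ShiftComplex.

Section ShiftMap.
Variables (X Y : complex) (f : chmap X Y).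

Fact shift_chP i j a :
  f (i + n) a *m cd (cshift Y) i j a = cd (cshift X) i j a *m f (j + n) a.
Proof. by rewrite /= -scalemxAl -scalemxAr chP. Qed.

Definition shift_chmap : chmap (cshift X) (cshift Y) :=
  @ChMap (cshift X) (cshift Y) _ shift_chP.

Fact shift_quasi_iso : quasi_iso f -> quasi_iso shift_chmap.
Proof.
have u : (-1) ^ n != 0 :> k by rewrite expfz_neq0// oppr_eq0 oner_eq0.
have kerE p q (M : 'M[k]_(p, q)) (x : 'rV_p) :
    x *m ((-1) ^ n *: M) = 0 <-> x *m M = 0.
  rewrite -scalemxAr; split=> [/eqP|->]; last by rewrite scaler0.
  by rewrite scaler_eq0 (negbTE u) => /eqP.
move=> hf h i j hi ij a; have [] := hf (h + n) (i + n) (j + n) _ _ a.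
- by lia.
- by lia.
move=> finj fsurj; split=> [x /kerE xd|y /kerE yd].
  by rewrite !(eqmx_scale _ u); apply: finj.
have [x [xd xy]] := fsurj y yd; exists x; split; first exact/kerE.
by rewrite (eqmx_scale _ u).
Qed.

End ShiftMap.

Definition shift_gen X Y (g : dgen X Y) : @mor k Db (cshift X) (cshift Y) :=
  match g with
  | DMap f => dmap (shift_chmap f)
  | DInv s hs => dinv (shift_quasi_iso hs)
  end.

Fact shift_gen_rel X Y (f g : expr k dgen X Y) : drel f g ->
  eval (C := Db) (F0 := cshift) shift_gen f = eval shift_gen g.
Proof.
move=> fg; case: {X Y} f g / fg => [X f fE|X Y Z g f h hE|X Y c f g h hE|
                                    X Y s hs|X Y s hs] /=.
- by apply: dmap_id => i a /=.
- by apply: dmap_comp => i a /=.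
- by apply: dmap_lin => i a /=.
- exact: dinvl.
- exact: dinvr.
Qed.

Definition shift_functor : linfunctor Db Db := extension shift_gen_rel.

End Shift.

(** The identity of [X i] when [i = j], and [0] otherwise. *)
Definition deg_id (X : complex) (i j : int) a : 'M[k]_(X i a, X j a) :=
  if i == j then pid_mx (X i a) else 0.

Lemma deg_id1 (X : complex) i a : deg_id X i i a = 1%:M.
Proof. by rewrite /deg_id eqxx pid_mx_1. Qed.

Lemma deg_id0 (X : complex) i j a : i <> j -> deg_id X i j a = 0.
Proof. by rewrite /deg_id; case: eqP. Qed.

Section Cone.
Variables (X Y : complex) (f : chmap X Y).

Definition cone_rep (i : int) : rep :=
  @Rep (fun a => X (i + 1)%R a + Y i a)%N
    (fun e => block_mx (rmap (X (i + 1)) e) 0 0 (rmap (Y i) e)).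

(** On row vectors: [d (x, y) = (- d x, f x + d y)]. *)
Definition cone_mx (i j : int) a : 'M_(cone_rep i a, cone_rep j a) :=
  block_mx (- cd X (i + 1) (j + 1) a) (deg_id X (i + 1) j a *m f j a)
           0 (cd Y i j a).

Fact cone_rhP i j e :
  rmap (cone_rep i) e *m cone_mx i j (tgt e) =
  cone_mx i j (src e) *m rmap (cone_rep j) e.
Proof.
rewrite /= /cone_mx !mulmx_block !(mul0mx, mulmx0, addr0, add0r).
rewrite !(mulmxN, mulNmx) !rhP; congr block_mx.
have [<-|ij] := eqVneq (i + 1) j; first by rewrite !deg_id1 !mul1mx rhP.
by rewrite !deg_id0 ?(mul0mx, mulmx0)//; apply/eqP.
Qed.

Fact cone_shape i j : j <> i + 1 -> forall a, cone_mx i j a = 0.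
Proof.
move=> ij a; have ij' : j + 1 <> i + 1 + 1 by lia.
rewrite /cone_mx !cd_shape// deg_id0; last by move=> /esym.
by rewrite mul0mx oppr0 block_mx0.
Qed.

Fact cone_dd i j l a : cone_mx i j a *m cone_mx j l a = 0.
Proof.
rewrite mulmx_block !(mul0mx, mulmx0, addr0, add0r) mulmxN mulNmx opprK !cdd.
suff -> : - cd X (i + 1) (j + 1) a *m (deg_id X (j + 1) l a *m f l a) +
          deg_id X (i + 1) j a *m f j a *m cd Y j l a = 0.
  exact: block_mx0.
have [<-{l}|jl] := eqVneq (j + 1) l; last first.
  have lj : l <> j + 1 by move/esym; apply/eqP.
  rewrite deg_id0; last exact/eqP.
  by rewrite (cd_shape Y lj) mul0mx !mulmx0 addr0.
rewrite deg_id1 mul1mx.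
have [<-|ij] := eqVneq (i + 1) j.
  by rewrite deg_id1 mul1mx mulNmx chP addNr.
have ij' : j + 1 <> i + 1 + 1 by move=> /addIr/esym; apply/eqP.
rewrite deg_id0; last exact/eqP.
by rewrite cd_shape// oppr0 !mul0mx addr0.
Qed.

Fact cone_bounded : exists N : nat, forall i : int, (N < `|i|)%N ->
  forall a, cone_rep i a = 0%N.
Proof.
have [N XN] := cx_bounded X; have [M YM] := cx_bounded Y.
exists (N + M + 1)%N => i iN a /=.
by rewrite XN ?YM//; lia.
Qed.

Definition cone : complex :=
  @Complex cone_rep (fun i j => RHom (cone_rhP i j))
    cone_shape cone_dd cone_bounded.

Fact cone_in_rhP i e :
  rmap (Y i) e *m row_mx 0 1%:M = row_mx 0 1%:M *m rmap (cone i) e.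
Proof.
by rewrite /= mul_mx_row mul_row_block !(mul0mx, mulmx0, mulmx1, mul1mx)
  !addr0 add0r.
Qed.

Fact cone_in_chP i j a :
  row_mx 0 1%:M *m cd cone i j a = cd Y i j a *m row_mx 0 1%:M.
Proof.
by rewrite /= mul_mx_row mul_row_block !(mul0mx, mulmx0, mulmx1, mul1mx)
  addr0 !add0r.
Qed.

Definition cone_in : chmap Y cone :=
  @ChMap Y cone
    (fun i => @RHom (Y i) (cone i) (fun a => row_mx 0 1%:M) (cone_in_rhP i))
    cone_in_chP.

Fact cone_out_rhP i e :
  rmap (cone i) e *m col_mx 1%:M 0 = col_mx 1%:M 0 *m rmap (cshift 1 X i) e.
Proof.
by rewrite [LHS]mul_block_col [RHS]mul_col_mx !(mul0mx, mulmx0, mulmx1, mul1mx)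
  !addr0.
Qed.

Fact cone_out_chP i j a :
  col_mx 1%:M 0 *m cd (cshift 1 X) i j a = cd cone i j a *m col_mx 1%:M 0.
Proof.
rewrite [LHS]mul_col_mx [RHS]mul_block_col.
by rewrite !(mul0mx, mulmx0, mulmx1, mul1mx) !addr0 -scaleN1r.
Qed.

Definition cone_out : chmap cone (cshift 1 X) :=
  @ChMap cone (cshift 1 X)
    (fun i => @RHom (cone i) (cshift 1 X i) (fun a => col_mx 1%:M 0)
                    (cone_out_rhP i))
    cone_out_chP.

End Cone.

Definition distinguished (A B C : Db) (u : mor A B) (v : mor B C)
    (w : @mor k Db C (cshift 1 A)) : Prop :=
  exists (X Y : complex) (f : chmap X Y) (a : @mor k Db A X) (b : @mor k Db B Y)
         (c : @mor k Db C (cone f)),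
    [/\ is_iso a, is_iso b & is_iso c] /\
    [/\ b ∘ u = dmap f ∘ a,
        c ∘ v = dmap (cone_in f) ∘ b
      & fmor (shift_functor 1) a ∘ w = dmap (cone_out f) ∘ c].

(** Almost split triangles; they determine [A] as the Auslander-Reiten
    translate of [C]. *)
Definition ar_triangle (A B C : Db) (u : mor A B) (v : mor B C)
    (w : @mor k Db C (cshift 1 A)) : Prop :=
  [/\ distinguished u v w, indecomposable A, indecomposable C, w <> 0 &
      forall (W : Db) (f : mor W C), ~ is_retraction f ->
        exists f' : mor W B, v ∘ f' = f].

Definition is_ar_translate (A C : Db) : Prop :=
  exists (B : Db) (u : mor A B) (v : mor B C) (w : @mor k Db C (cshift 1 A)),
    ar_triangle u v w.

Section DirectSum.
Variables X Y : complex.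

Definition dsum_rep (i : int) : rep :=
  @Rep (fun a => X i a + Y i a)%N
    (fun e => block_mx (rmap (X i) e) 0 0 (rmap (Y i) e)).

Definition dsum_mx (i j : int) a : 'M_(dsum_rep i a, dsum_rep j a) :=
  block_mx (cd X i j a) 0 0 (cd Y i j a).

Fact dsum_rhP i j e :
  rmap (dsum_rep i) e *m dsum_mx i j (tgt e) =
  dsum_mx i j (src e) *m rmap (dsum_rep j) e.
Proof.
by rewrite /= !mulmx_block !(mul0mx, mulmx0, addr0, add0r) !rhP.
Qed.

Fact dsum_shape i j : j <> i + 1 -> forall a, dsum_mx i j a = 0.
Proof. by move=> ij a; rewrite /dsum_mx !cd_shape// block_mx0. Qed.

Fact dsum_dd i j l a : dsum_mx i j a *m dsum_mx j l a = 0.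
Proof.
by rewrite mulmx_block !(mul0mx, mulmx0, addr0, add0r) !cdd block_mx0.
Qed.

Fact dsum_bounded : exists N : nat, forall i : int, (N < `|i|)%N ->
  forall a, dsum_rep i a = 0%N.
Proof.
have [N XN] := cx_bounded X; have [M YM] := cx_bounded Y.
exists (N + M)%N => i iN a /=.
by rewrite XN ?YM//; lia.
Qed.

Definition dsum : Db :=
  @Complex dsum_rep (fun i j => RHom (dsum_rhP i j))
    dsum_shape dsum_dd dsum_bounded.

End DirectSum.

(** The class in the Grothendieck group, in the basis of the simple
    representations.  Here and in [half_euler], [\sum_(i \in A)] is the sum of a
    finitely supported family. *)
Definition dimvec (X : Db) (a : Q0) : int :=
  \sum_(i \in [set: int]%classic) (-1) ^ i * ((X : complex) i a)%:Z.

(** [X, Y]^i = dim Hom (X, Y[i]) *)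
Definition hdim (X Y : Db) (i : int) : nat := ldim (@mor k Db X (cshift i Y)).

(** <X, Y> = \sum_(i <= 0) (-1)^i [X, Y]^i *)
Definition half_euler (X Y : Db) : int :=
  \sum_(i \in [set i : int | i <= 0]%classic) (-1) ^ i * (hdim X Y i)%:Z.

End Representations.

Section TranslationQuiver.
Variables (k : fieldType) (D0 : finType) (adj : rel D0) (x0 : D0).

(** The parity class of [(0, x0)]; the other class indexes the meshes. *)
Definition v_class (z : int * D0) : bool :=
  (2 %| z.1 + (gdist adj x0 z.2)%:Z)%Z.

Definition zvertex := {z : int * D0 | v_class z}.
Definition mesh := {z : int * D0 | ~~ v_class z}.

Definition zarrow (x y : zvertex) : bool :=
  adj (val x).2 (val y).2 && ((val y).1 == (val x).1 + 1).

Fact mesh_src_subproof (m : mesh) : v_class ((val m).1 - 1, (val m).2).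
Proof. by case: m => -[p a]; rewrite /v_class /= => ?; lia. Qed.

Fact mesh_tgt_subproof (m : mesh) : v_class ((val m).1 + 1, (val m).2).
Proof. by case: m => -[p a]; rewrite /v_class /= => ?; lia. Qed.

Definition mesh_src (m : mesh) : zvertex := Sub _ (mesh_src_subproof m).
Definition mesh_tgt (m : mesh) : zvertex := Sub _ (mesh_tgt_subproof m).

(** The vertices [(p, b)] with [b] adjacent to [a], for the mesh [(p, a)]. *)
Definition mesh_mid (m : mesh) : seq zvertex :=
  pmap insub [seq ((val m).1, b) | b <- enum D0 & adj (val m).2 b].

Definition earrow (x y : zvertex) : expr k zarrow x y :=
  if @idP (zarrow x y) is ReflectT xy then EGen xy else EZero.

Definition mesh_sum (m : mesh) : expr k zarrow (mesh_src m) (mesh_tgt m) :=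
  \big[@EAdd _ _ _ _ _/EZero]_(y <- mesh_mid m)
    EComp (earrow y (mesh_tgt m)) (earrow (mesh_src m) y).

Inductive mesh_rel : relations k zarrow :=
| mesh_rel0 m : mesh_rel (mesh_sum m) EZero.

Definition mesh_category : lincat k := presented mesh_rel.

End TranslationQuiver.

(** Identifications of the vertices of the translation quiver with a complete
    set of pairwise non-isomorphic indecomposable objects, underlying an
    equivalence of the mesh category with the category of indecomposable objects
    and compatible with the Auslander-Reiten translation. *)
Record ar_identification (k : fieldType) (D0 : finType) (adj : rel D0)
    (x0 : D0) (Q : quiver D0) := ARIdentification {
  ar_functor : linfunctor (mesh_category k adj x0) (Db k Q);
  ar_ff : fully_faithful ar_functor;
  ar_indec : forall x, indecomposable (ar_functor x);
  ar_complete : forall X : Db k Q, indecomposable X ->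
    exists x, isomorphic X (ar_functor x);
  ar_distinct : forall x y,
    isomorphic (ar_functor x) (ar_functor y) -> x = y;
  ar_translate : forall m : mesh adj x0,
    is_ar_translate (ar_functor (mesh_src m)) (ar_functor (mesh_tgt m))
}.

Section Delta.
Variables (k : fieldType) (D0 : finType) (adj : rel D0) (x0 : D0).
Variables (Q : quiver D0) (v : ar_identification k adj x0 Q).

Definition delta_triangle (A B C : Db k Q) (u : mor A B) (w : mor B C)
    (g : @mor k (Db k Q) C (cshift 1 A)) (_ : distinguished u w g) :
    mesh adj x0 -> int :=
  fun m => (rk (fun f : mor (ar_functor v (mesh_tgt m)) C => g ∘ f))%:Z.

Definition delta_pair (M N : Db k Q) (_ : dimvec M = dimvec N) :
    mesh adj x0 -> int :=
  fun m => half_euler (ar_functor v (mesh_tgt m)) N -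
           half_euler (ar_functor v (mesh_tgt m)) M.

End Delta.

(* Main.v *)
Require Import Defs.
From HB Require Import structures.
From mathcomp Require Import all_boot all_order all_algebra generic_quotient.
From mathcomp Require Import boolp classical_sets functions cardinality fsbigop.
From mathcomp Require Import zify ring.

Set Implicit Arguments.
Unset Strict Implicit.
Unset Printing Implicit Defensive.

Import GRing.Theory Num.Theory.
Local Open Scope ring_scope.

(** Morphisms of [Db] are computed by coherent maps: a coherent map [V ~> X] is
    a chain map at every vertex together with, for every arrow, a homotopy making
    the square of this arrow commute.  Coherent maps modulo homotopy form a linear
    category [HH] on the same objects.  Acyclic complexes of vector spaces are
    contractible, so that quasi-isomorphisms become invertible in [HH], whence a
    functor [phi] from [Db] to [HH].  Conversely the cylinder of a coherent map
    [p : V ~> X] is a complex of representations that contains [V], and [X] by a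
    quasi-isomorphism; the roof [V -> cyl p <- X] is a morphism [theta p] of [Db],
    and a Yoneda argument shows that [theta] inverts [phi].

    In [HH], hence in [Db], [Hom(V, -)] is exact in the middle of degreewise split
    short exact sequences of complexes.  For the cones and cylinders of chain maps
    this yields the long exact sequence of a triangle.  Since Hom spaces are finite
    dimensional and vanish in degrees far from 0, the alternating sum of dimensions
    over the degrees [<= 0] telescopes to the rank of the connecting map in
    degree 0.  Classes in the Grothendieck group are additive on cones and are
    invariant under isomorphism because coherent homotopy equivalences preserve
    the dimensions of homology.

    Matrices act on row vectors: [f *m g] is [f] followed by [g]. *)

(** * Dimensions and ranks *)

Section LinearAlgebra.
Variable k : fieldType.
Implicit Types U W : lmodType k.

Lemma lin_fun0 U W (f : U -> W) : linear f -> f 0 = 0.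
Proof.
by move=> fl; have := fl (-1) 0 0; rewrite scaler0 addr0 scaleN1r addNr.
Qed.

Lemma lin_funZ U W (f : U -> W) c x : linear f -> f (c *: x) = c *: f x.
Proof. by move=> fl; rewrite -[c *: x]addr0 fl lin_fun0// addr0. Qed.

Lemma lin_funD U W (f : U -> W) x y : linear f -> f (x + y) = f x + f y.
Proof. by move=> fl; rewrite -[x]scale1r fl !scale1r. Qed.

Lemma lin_funN U W (f : U -> W) x : linear f -> f (- x) = - f x.
Proof. by move=> fl; rewrite -scaleN1r lin_funZ// scaleN1r. Qed.

Lemma lin_funB U W (f : U -> W) x y : linear f -> f (x - y) = f x - f y.
Proof. by move=> fl; rewrite lin_funD// lin_funN. Qed.

Lemma lin_fun_sum U W (f : U -> W) n (c : 'I_n -> k) (e : 'I_n -> U) :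
  linear f -> f (\sum_i c i *: e i) = \sum_i c i *: f (e i).
Proof.
move=> fl; elim/big_rec2: _ => [|i y x _ <-]; first exact: lin_fun0.
exact: fl.
Qed.

Definition hasdim U (A : set U) (n : nat) := exists e, @basis_of_set k U A n e.

(** A matrix of maximal rank among those whose row space lies in [A]. *)
Lemma rowspace_of_closed n (A : set 'rV[k]_n) :
  A 0 -> (forall c x y, A x -> A y -> A (c *: x + y)) ->
  exists (m : nat) (M : 'M[k]_(m, n)),
    row_free M /\ forall x, A x <-> (x <= M)%MS.
Proof.
move=> A0 Acl.
pose P r := `[< exists M : 'M[k]_n,
  \rank M = r /\ forall x : 'rV_n, (x <= M)%MS -> A x >].
have exP : exists r, P r.
  by exists 0%N; apply/asboolP; exists 0; split; [exact: mxrank0 |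
    move=> x; rewrite submx0 => /eqP ->].
have leP r : P r -> (r <= n)%N.
  by move=> /asboolP[M [<- _]]; exact: rank_leq_row.
case: (ex_maxnP exP leP) => r /asboolP[M [rM MA]] rmax.
exists (\rank M), (row_base M); split; first exact: row_base_free.
move=> x; rewrite eq_row_base; split=> [Ax|]; last exact: MA.
have : (M + x <= M)%MS.
  have [_ <-] := mxrank_leqif_sup (addsmxSl M x).
  rewrite eqn_leq mxrankS ?addsmxSl//= rM; apply: rmax; apply/asboolP.
  exists (M + x)%MS; split=> // y /sub_addsmxP[[u1 u2] /= ->].
  rewrite addrC [u2]mx11_scalar mul_scalar_mx; apply: Acl => //.
  by apply: MA; exact: submxMl.
exact: submx_trans (addsmxSr _ _).
Qed.

Definition lincomb U n (e : 'I_n -> U) (c : 'rV[k]_n) := \sum_i c 0 i *: e i.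

Lemma lincomb_linear U n (e : 'I_n -> U) : linear (lincomb e).
Proof.
move=> c x y; rewrite /lincomb scaler_sumr -big_split; apply: eq_bigr => i _.
by rewrite !mxE scalerDl scalerA.
Qed.

Lemma lincombE U n (f : 'rV[k]_n -> U) x : linear f ->
  f x = lincomb (fun i => f (delta_mx 0 i)) x.
Proof. by move=> fl; rewrite {1}[x]row_sum_delta lin_fun_sum. Qed.

Lemma hasdimP U (A : set U) n : hasdim A n <->
  exists f : 'rV[k]_n -> U, [/\ linear f, injective f & A = range f].
Proof.
split=> [[e [free spanA]]|[f [fl finj ->]]].
  exists (lincomb e); split.
  - exact: lincomb_linear.
  - move=> x y /eqP; rewrite -subr_eq0 -lin_funB; last exact: lincomb_linear.
    move=> /eqP xy; apply/rowP => i; apply/eqP; rewrite -subr_eq0.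
    by have := free (fun i => (x - y) 0 i) xy i; rewrite !mxE => ->.
  - rewrite spanA; apply/seteqP; split=> x /= [c].
      move=> ->; exists (\row_i c i) => //.
      by apply: eq_bigr => i _; rewrite mxE.
    by move=> _ <-; exists (c 0).
exists (fun i => f (delta_mx 0 i)); split=> [c c0 i|].
  have /finj/rowP/(_ i) : f (\row_i c i) = f 0.
    rewrite lin_fun0// -c0 (lincombE _ fl).
    by apply: eq_bigr => j _; rewrite mxE.
  by rewrite !mxE.
apply/seteqP; split=> x /=.
  move=> [c _ <-]; exists (c 0).
  exact: lincombE.
move=> [c ->]; exists (\row_i c i) => //.
by rewrite (lincombE _ fl); apply: eq_bigr => j _; rewrite mxE.
Qed.

Lemma hasdim_leq U (A : set U) m n : hasdim A m -> hasdim A n -> (m <= n)%N.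
Proof.
move=> /hasdimP[f [fl finj Af]] /hasdimP[g [gl ginj Ag]].
have /choice[M fM] : forall i, exists c : 'rV_n, g c = f (delta_mx 0 i).
  move=> i; have : A (f (delta_mx 0 i)) by rewrite Af; exists (delta_mx 0 i).
  by rewrite Ag => -[c _ <-]; exists c.
pose P := \matrix_i M i.
have gP x : g (x *m P) = f x.
  rewrite (lincombE x fl) mulmx_sum_row lin_fun_sum//.
  by apply: eq_bigr => i _; rewrite rowK fM.
have : row_free P.
  rewrite -kermx_eq0; apply/eqP/row_matrixP => i; rewrite row0; apply: finj.
  rewrite -gP -row_mul mulmx_ker row0 lin_fun0// lin_fun0//.
by move=> /eqP <-; exact: rank_leq_col.
Qed.

Lemma sdim_hasdim U (A : set U) n : hasdim A n -> sdim A = n.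
Proof.
move=> An; apply/eqP; rewrite eqn_leq.
have : hasdim A (sdim A) by rewrite /sdim; case: xgetP => [m _ //|/(_ n)].
by move=> Am; rewrite !(hasdim_leq Am An, hasdim_leq An Am).
Qed.

Lemma range_linear_hasdim n W (f : 'rV[k]_n -> W) : linear f ->
  exists m (K : 'M[k]_(m, n)), [/\ row_free K,
    forall x, f x = 0 <-> (x <= K)%MS & hasdim (range f) (n - m)].
Proof.
move=> fl; have [||m [K [Kfree kerf]]] :=
    @rowspace_of_closed n [set x | f x = 0]%classic.
- exact: lin_fun0.
- by move=> c x y /= fx fy; rewrite fl fx fy scaler0 addr0.
exists m, K; split=> //; have <- : \rank (K^C)%MS = (n - m)%N.
  by rewrite mxrank_compl (eqP Kfree).
apply/hasdimP; exists (fun x => f (x *m row_base (K^C)%MS)); split.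
- by move=> c x y; rewrite mulmxDl -scalemxAl fl.
- move=> x y /eqP; rewrite -subr_eq0 -lin_funB// -mulmxBl => /eqP/kerf xyK.
  have : ((x - y) *m row_base (K^C)%MS <= K :&: K^C)%MS.
    by rewrite sub_capmx xyK -(eq_row_base (K^C)%MS) submxMl.
  rewrite capmx_compl submx0 mulmx_free_eq0 ?row_base_free// subr_eq0.
  by move/eqP.
apply/seteqP; split=> y /= [x _ <-]; last by exists (x *m row_base (K^C)%MS).
have : (x <= K + K^C)%MS by rewrite submx_full// addsmx_compl_full.
move=> /sub_addsmxP[[u1 u2] /= ->].
have /submxP[v ->] : (u2 *m K^C <= row_base (K^C)%MS)%MS.
  by rewrite eq_row_base submxMl.
exists v => //; rewrite lin_funD//.
by rewrite (_ : f (u1 *m K) = 0) ?add0r//; apply/kerf/submxMl.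
Qed.

Definition findim U := exists n, hasdim [set: U]%classic n.

Lemma rank_nullity U W (f : U -> W) : findim U -> linear f ->
  (ldim U = rk f + sdim [set x | f x = 0%R]%classic)%N.
Proof.
move=> [n Un] fl; rewrite {1}/ldim (sdim_hasdim Un).
have /hasdimP[e [el einj /esym esurj]] := Un.
have sE x : exists c, e c = x.
  by have : [set: U]%classic x by []; rewrite -esurj => -[c _ <-]; exists c.
have fel : linear (f \o e) by move=> c x y /=; rewrite el fl.
have [m [K [Kfree kerf dimf]]] := range_linear_hasdim fel.
have -> : rk f = (n - m)%N.
  apply: sdim_hasdim; suff <- : range (f \o e) = range f by [].
  apply/seteqP; split=> y /= [x _ <-]; first by exists (e x).
  by have [c <-] := sE x; exists c.
rewrite (@sdim_hasdim _ _ m).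
  by rewrite subnK// -(eqP Kfree) rank_leq_col.
apply/hasdimP; exists (fun x => e (x *m K)); split.
- by move=> c x y; rewrite mulmxDl -scalemxAl el.
- by move=> x y /einj/(row_free_inj Kfree).
apply/seteqP; split=> x /=.
  have [c <-] := sE x; move=> /kerf/submxP[u ->].
  by exists u.
by move=> [c _ <-]; apply/kerf/submxMl.
Qed.

Lemma findim_surj U W (f : U -> W) : findim U -> linear f ->
  (forall y, exists x, f x = y) -> findim W.
Proof.
move=> [n /hasdimP[e [el _ /esym esurj]]] fl fsurj.
have fel : linear (f \o e) by move=> c x y /=; rewrite el fl.
have [m [K [_ _]]] := range_linear_hasdim fel.
suff -> : range (f \o e) = [set: W]%classic by exists (n - m)%N.
apply/seteqP; split=> // y _; have [x <-] := fsurj y.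
by have : [set: U]%classic x by []; rewrite -esurj => -[c _ <-]; exists c.
Qed.

Lemma findim_separated U (Z : Type) (I : finType) (cls : Z -> U)
    (ev : I -> Z -> k) :
  (forall u, exists z, cls z = u) ->
  (forall c z z', exists z'', cls z'' = c *: cls z + cls z' /\
     forall i, ev i z'' = c * ev i z + ev i z') ->
  (forall z, (forall i, ev i z = 0) -> cls z = 0) ->
  findim U.
Proof.
move=> surj comb sep.
pose vec z : 'rV[k]_#|I| := \row_i ev (enum_val i) z.
have vec_inj z z' : vec z = vec z' -> cls z = cls z'.
  move=> zz'; have [z'' [clsE evE]] := comb (-1) z z'.
  have /(_ _)/esym/eqP := sep z''; rewrite clsE scaleN1r addrC eq_sym subr_eq0.
  move=> h; apply/esym/eqP/h => i; rewrite evE.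
  have /rowP/(_ (enum_rank i)) := zz'.
  by rewrite !mxE enum_rankK => ->; rewrite mulN1r addNr.
have vec_comb c z z' : exists z'',
    cls z'' = c *: cls z + cls z' /\ vec z'' = c *: vec z + vec z'.
  have [z'' [clsE evE]] := comb c z z'; exists z''; split=> //.
  by apply/rowP => i; rewrite !mxE evE.
have [z0 [z0E v0E]] : exists z0, cls z0 = 0 /\ vec z0 = 0.
  have [z _] := surj 0; have [z' [z'E v'E]] := vec_comb (-1) z z.
  by exists z'; rewrite z'E v'E !scaleN1r !addNr.
have [||m [M [_ MP]]] := @rowspace_of_closed #|I| (range vec).
- by exists z0.
- move=> c _ _ [z _ <-] [z' _ <-]; have [z'' [_ <-]] := vec_comb c z z'.
  by exists z''.
have /choice[b bM] : forall i, exists z, vec z = row i M.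
  by move=> i; have /MP[z _ zE] := row_sub i M; exists z.
have dimrow : findim 'rV[k]_m.
  by exists m; apply/hasdimP; exists id; split=> //; rewrite image_id.
apply: (findim_surj dimrow (lincomb_linear (fun i => cls (b i)))).
move=> u; have [z <-] := surj u.
have /MP/submxP[c zc] : range vec (vec z) by exists z.
exists c; suff [z' [<- /vec_inj->]] : exists z',
    cls z' = lincomb (fun i => cls (b i)) c /\ vec z' = vec z.
  by [].
rewrite zc mulmx_sum_row /lincomb.
elim/big_rec2: _ => [|i y x _ [z' [cE vE]]]; first by exists z0.
have [z'' [z''E v''E]] := vec_comb (c 0 i) (b i) z'.
by exists z''; rewrite z''E v''E bM cE vE.
Qed.

Lemma rk_conj U U' W W' (f : U -> W) (f' : U' -> W') (a : U -> U')
    (b : W -> W') :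
  findim U -> linear f -> linear f' -> linear b -> linear a ->
  (forall y, exists x, a x = y) -> injective b ->
  (forall x, f' (a x) = b (f x)) -> rk f' = rk f.
Proof.
move=> fU fl fl' bl al asurj binj comm.
have [n /hasdimP[e [el einj eE]]] : exists n, hasdim (range f) n.
  have [n /hasdimP[e [el _ /esym esurj]]] := fU.
  have fel : linear (f \o e) by move=> c x y /=; rewrite el fl.
  have [m [K [_ _ h]]] := range_linear_hasdim fel.
  exists (n - m)%N; suff <- : range (f \o e) = range f by [].
  apply/seteqP; split=> y /= [x _ <-]; first by exists (e x).
  by have : [set: U]%classic x by []; rewrite -esurj => -[c _ <-]; exists c.
have -> : rk f = n by apply: sdim_hasdim; apply/hasdimP; exists e.
apply: sdim_hasdim; apply/hasdimP; exists (b \o e); split.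
- by move=> c x y /=; rewrite el bl.
- exact: inj_comp.
apply/seteqP; split=> y /= [x _ <-].
  have [u <-] := asurj x; rewrite comm.
  have : range f (f u) by exists u.
  by rewrite eE => -[c _ <-]; exists c.
have : range e (e x) by exists x.
by rewrite -eE => -[u _ <-]; exists (a u).
Qed.

Lemma ldim_bij U W (f : U -> W) : findim U -> linear f -> bijective f ->
  ldim U = ldim W.
Proof.
move=> [n /hasdimP[e [el einj eE]]] fl [g fK gK].
rewrite /ldim (@sdim_hasdim U _ n); last by apply/hasdimP; exists e.
apply/esym/sdim_hasdim/hasdimP; exists (f \o e); split.
- by move=> c x y /=; rewrite el fl.
- by apply: inj_comp => //; exact: can_inj fK.
apply/seteqP; split=> // y _.
have : [set: U]%classic (g y) by []; rewrite eE => -[c _ cE]; exists c => //=.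
by rewrite cE gK.
Qed.

End LinearAlgebra.

(** * Coherent maps *)

Section MatrixEntries.
Variable R : comPzRingType.

Lemma mxaddE m n (A B : 'M[R]_(m, n)) i j : (A + B) i j = A i j + B i j.
Proof. by rewrite mxE. Qed.

Lemma mxoppE m n (A : 'M[R]_(m, n)) i j : (- A) i j = - A i j.
Proof. by rewrite mxE. Qed.

Lemma mxscaleE m n c (A : 'M[R]_(m, n)) i j : (c *: A) i j = c * A i j.
Proof. by rewrite mxE. Qed.

Lemma mxzeroE m n i j : (0 : 'M[R]_(m, n)) i j = 0.
Proof. by rewrite mxE. Qed.

End MatrixEntries.

Ltac mxlin :=
  apply/matrixP => ? ?; rewrite ?(mxaddE, mxoppE, mxscaleE, mxzeroE); ring.
Ltac mxexpand :=
  rewrite ?(mulmxDl, mulmxDr, mulNmx, mulmxN, mul0mx, mulmx0, mulmxA);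
  rewrite -?(scalemxAl, scalemxAr).

Section CoherentMaps.
Variables (k : fieldType) (Q0 : finType) (Q : quiver Q0).
Notation complex := (complex k Q).
Implicit Types V W X Y Z : complex.

(** [coh_h i j e] is a null-homotopy of the square of [e]; only the degrees
    [i = j + 1] matter. *)
Record coh V X := Coh {
  coh_f : forall i a, 'M[k]_(V i a, X i a);
  coh_h : forall (i j : int) (e : arrow Q), 'M[k]_(V i (src e), X j (tgt e));
  coh_chain : forall i j a,
    coh_f i a *m cd X i j a = cd V i j a *m coh_f j a;
  coh_square : forall i j l, j = i + 1 -> l = j + 1 -> forall e,
    rmap (V j) e *m coh_f j (tgt e) - coh_f j (src e) *m rmap (X j) e =
    cd V j l (src e) *m coh_h l j e + coh_h j i e *m cd X i j (tgt e)
}.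

Definition coh_eq V X (p q : coh V X) : Prop :=
  (forall i a, coh_f p i a = coh_f q i a) /\
  (forall i j e, i = j + 1 -> coh_h p i j e = coh_h q i j e).

(** The coboundary of a pair [(s, t)], in consecutive degrees [u, i, j, l]: only
    [s j i] with [j = i + 1] and [t l i] with [l = i + 2] matter. *)
Definition boundary_f V X (s : forall i j a, 'M[k]_(V i a, X j a))
    (i j l : int) a : 'M[k]_(V j a, X j a) :=
  cd V j l a *m s l j a + s j i a *m cd X i j a.

Definition boundary_h V X (s : forall i j a, 'M[k]_(V i a, X j a))
    (t : forall i j e, 'M[k]_(V i (src e), X j (tgt e)))
    (p i j l : int) e : 'M[k]_(V j (src e), X i (tgt e)) :=
  rmap (V j) e *m s j i (tgt e) - s j i (src e) *m rmap (X i) e +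
  cd V j l (src e) *m t l i e - t j p e *m cd X p i (tgt e).

Definition homotopic V X (p q : coh V X) : Prop :=
  exists (s : forall i j a, 'M[k]_(V i a, X j a))
         (t : forall i j e, 'M[k]_(V i (src e), X j (tgt e))),
    (forall i j l, j = i + 1 -> l = j + 1 -> forall a,
       coh_f p j a - coh_f q j a = boundary_f s i j l a) /\
    (forall u i j l, i = u + 1 -> j = i + 1 -> l = j + 1 -> forall e,
       coh_h p j i e - coh_h q j i e = boundary_h s t u i j l e).

Lemma coh_eq_homotopic V X (p q : coh V X) : coh_eq p q -> homotopic p q.
Proof.
move=> [fE hE]; exists (fun _ _ _ => 0), (fun _ _ _ => 0).
split=> [i j l _ _ a|u i j l iu ji _ e].
  by rewrite fE /boundary_f; mxexpand; mxlin.
by rewrite hE// /boundary_h; mxexpand; mxlin.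
Qed.

Fact coh_comb_chain V X c d (p q : coh V X) i j a :
  (c *: coh_f p i a + d *: coh_f q i a) *m cd X i j a =
  cd V i j a *m (c *: coh_f p j a + d *: coh_f q j a).
Proof. by mxexpand; rewrite !coh_chain. Qed.

Fact coh_comb_square V X c d (p q : coh V X) i j l :
  j = i + 1 -> l = j + 1 -> forall e,
  rmap (V j) e *m (c *: coh_f p j (tgt e) + d *: coh_f q j (tgt e)) -
  (c *: coh_f p j (src e) + d *: coh_f q j (src e)) *m rmap (X j) e =
  cd V j l (src e) *m (c *: coh_h p l j e + d *: coh_h q l j e) +
  (c *: coh_h p j i e + d *: coh_h q j i e) *m cd X i j (tgt e).
Proof.
move=> ji lj e.
have hp := coh_square p ji lj e; have hq := coh_square q ji lj e.
transitivity (c *: (rmap (V j) e *m coh_f p j (tgt e) -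
    coh_f p j (src e) *m rmap (X j) e) +
    d *: (rmap (V j) e *m coh_f q j (tgt e) -
    coh_f q j (src e) *m rmap (X j) e)).
  by mxexpand; mxlin.
by rewrite hp hq; mxexpand; mxlin.
Qed.

Definition coh_comb V X c d (p q : coh V X) : coh V X :=
  Coh (coh_comb_chain c d p q) (coh_comb_square c d p q).

Fact coh_zero_chain V X i j a :
  0 *m cd X i j a = cd V i j a *m (0 : 'M_(V j a, X j a)).
Proof. by rewrite mul0mx mulmx0. Qed.

Fact coh_zero_square V X (i j l : int) :
  j = i + 1 -> l = j + 1 -> forall e,
  rmap (V j) e *m (0 : 'M_(V j (tgt e), X j (tgt e))) - 0 *m rmap (X j) e =
  cd V j l (src e) *m (0 : 'M_(V l (src e), X j (tgt e))) +
  (0 : 'M_(V j (src e), X i (tgt e))) *m cd X i j (tgt e).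
Proof. by move=> _ _ e; rewrite !(mul0mx, mulmx0) subr0 addr0. Qed.

Definition coh_zero V X : coh V X :=
  Coh (@coh_zero_chain V X) (@coh_zero_square V X).

Lemma homotopic_comb V X c d (p p' q q' : coh V X) :
  homotopic p p' -> homotopic q q' ->
  homotopic (coh_comb c d p q) (coh_comb c d p' q').
Proof.
move=> [s [t [sE tE]]] [s' [t' [s'E t'E]]].
exists (fun i j a => c *: s i j a + d *: s' i j a),
       (fun i j e => c *: t i j e + d *: t' i j e).
split=> [i j l ji lj a|u i j l iu ji lj e] /=.
  transitivity (c *: (coh_f p j a - coh_f p' j a) +
                d *: (coh_f q j a - coh_f q' j a)); first by mxlin.
  by rewrite (sE i _ l)// (s'E i _ l)// /boundary_f; mxexpand; mxlin.
transitivity (c *: (coh_h p j i e - coh_h p' j i e) +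
              d *: (coh_h q j i e - coh_h q' j i e)); first by mxlin.
by rewrite (tE u _ _ l)// (t'E u _ _ l)// /boundary_h; mxexpand; mxlin.
Qed.

Lemma homotopic_sym V X (p q : coh V X) : homotopic p q -> homotopic q p.
Proof.
move=> [s [t [sE tE]]].
exists (fun i j a => - s i j a), (fun i j e => - t i j e).
split=> [i j l ji lj a|u i j l iu ji lj e].
  by rewrite -opprB (sE i _ l)// /boundary_f; mxexpand; mxlin.
by rewrite -opprB (tE u _ _ l)// /boundary_h; mxexpand; mxlin.
Qed.

Lemma homotopic_trans V X (p q r : coh V X) :
  homotopic p q -> homotopic q r -> homotopic p r.
Proof.
move=> [s [t [sE tE]]] [s' [t' [s'E t'E]]].
exists (fun i j a => s i j a + s' i j a), (fun i j e => t i j e + t' i j e).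
split=> [i j l ji lj a|u i j l iu ji lj e].
  transitivity ((coh_f p j a - coh_f q j a) + (coh_f q j a - coh_f r j a));
    first by mxlin.
  by rewrite (sE i _ l)// (s'E i _ l)// /boundary_f; mxexpand; mxlin.
transitivity ((coh_h p j i e - coh_h q j i e) +
              (coh_h q j i e - coh_h r j i e));
  first by mxlin.
by rewrite (tE u _ _ l)// (t'E u _ _ l)// /boundary_h; mxexpand; mxlin.
Qed.

Lemma homotopic_refl V X (p : coh V X) : homotopic p p.
Proof. by apply: coh_eq_homotopic; split. Qed.

Lemma coh_rmapE V X (p : coh V X) i j l e : j = i + 1 -> l = j + 1 ->
  rmap (V j) e *m coh_f p j (tgt e) =
  coh_f p j (src e) *m rmap (X j) e + cd V j l (src e) *m coh_h p l j e +
  coh_h p j i e *m cd X i j (tgt e).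
Proof.
by move=> ji lj; rewrite -addrA -(coh_square p ji lj) addrC subrK.
Qed.

Section Composition.
Variables V X Y : complex.

Fact coh_comp_chain (p : coh V X) (q : coh X Y) i j a :
  (coh_f p i a *m coh_f q i a) *m cd Y i j a =
  cd V i j a *m (coh_f p j a *m coh_f q j a).
Proof. by rewrite -mulmxA coh_chain mulmxA coh_chain mulmxA. Qed.

Fact coh_comp_square (p : coh V X) (q : coh X Y) i j l :
  j = i + 1 -> l = j + 1 -> forall e,
  rmap (V j) e *m (coh_f p j (tgt e) *m coh_f q j (tgt e)) -
  (coh_f p j (src e) *m coh_f q j (src e)) *m rmap (Y j) e =
  cd V j l (src e) *m (coh_f p l (src e) *m coh_h q l j e +
                       coh_h p l j e *m coh_f q j (tgt e)) +
  (coh_f p j (src e) *m coh_h q j i e +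
   coh_h p j i e *m coh_f q i (tgt e)) *m cd Y i j (tgt e).
Proof.
move=> ji lj e; rewrite mulmxA (coh_rmapE p _ ji lj).
rewrite !mulmxDl -!mulmxA (coh_rmapE q _ ji lj) !mulmxDr.
rewrite -(coh_chain q i j) !mulmxA -(coh_chain p j l).
by mxlin.
Qed.

Definition coh_comp (q : coh X Y) (p : coh V X) : coh V Y :=
  Coh (coh_comp_chain p q) (coh_comp_square p q).

Lemma homotopic_compl (q : coh X Y) (p p' : coh V X) :
  homotopic p p' -> homotopic (coh_comp q p) (coh_comp q p').
Proof.
move=> [s [t [sE tE]]].
exists (fun i j a => s i j a *m coh_f q j a),
  (fun i j e => t i j e *m coh_f q j (tgt e) +
                s i (j + 1) (src e) *m coh_h q (j + 1) j e).
split=> [i j l ji lj a|u i j l iu ji lj e] /=.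
  rewrite -mulmxBl (sE i _ l)// /boundary_f mulmxDl -!mulmxA.
  by rewrite coh_chain.
have -> : coh_f p j (src e) *m coh_h q j i e +
    coh_h p j i e *m coh_f q i (tgt e) -
    (coh_f p' j (src e) *m coh_h q j i e +
     coh_h p' j i e *m coh_f q i (tgt e)) =
    (coh_f p j (src e) - coh_f p' j (src e)) *m coh_h q j i e +
    (coh_h p j i e - coh_h p' j i e) *m coh_f q i (tgt e).
  by mxexpand; mxlin.
rewrite (sE i _ l)// (tE u _ _ l)// /boundary_f /boundary_h -iu -ji.
have sq := coh_rmapE q e iu ji.
move: (coh_chain q u i (tgt e)) sq => qc sq.
rewrite !(mulmxDl, mulmxDr, mulNmx) -!mulmxA sq qc !(mulmxDr, mulmxN, mulmxA).
by mxlin.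
Qed.

Lemma homotopic_compr (q q' : coh X Y) (p : coh V X) :
  homotopic q q' -> homotopic (coh_comp q p) (coh_comp q' p).
Proof.
move=> [s [t [sE tE]]].
exists (fun i j a => coh_f p i a *m s i j a),
  (fun i j e => coh_f p i (src e) *m t i j e -
                coh_h p i (j + 1) e *m s (j + 1) j (tgt e)).
split=> [i j l ji lj a|u i j l iu ji lj e] /=.
  rewrite -mulmxBr (sE i _ l)// /boundary_f mulmxDr !mulmxA.
  by rewrite coh_chain.
have -> : coh_f p j (src e) *m coh_h q j i e +
    coh_h p j i e *m coh_f q i (tgt e) -
    (coh_f p j (src e) *m coh_h q' j i e +
     coh_h p j i e *m coh_f q' i (tgt e)) =
    coh_f p j (src e) *m (coh_h q j i e - coh_h q' j i e) +
    coh_h p j i e *m (coh_f q i (tgt e) - coh_f q' i (tgt e)).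
  by mxexpand; mxlin.
rewrite (sE u _ j)// (tE u _ _ l)// /boundary_f /boundary_h -iu -ji.
rewrite !(mulmxDl, mulmxDr, mulNmx, mulmxN) !mulmxA.
have sq := coh_rmapE p e ji lj.
rewrite sq (coh_chain p j l).
by rewrite !(mulmxDl, mulmxDr, mulNmx, mulmxN, mulmxA); mxlin.
Qed.

End Composition.

Lemma homotopic_comp V X Y (q q' : coh X Y) (p p' : coh V X) :
  homotopic q q' -> homotopic p p' -> homotopic (coh_comp q p) (coh_comp q' p').
Proof.
move=> qq' pp'; apply: homotopic_trans (homotopic_compl q pp') _.
exact: homotopic_compr.
Qed.

Fact gen_chain X Y (f : chmap X Y) i j a :
  f i a *m cd Y i j a = cd X i j a *m f j a.
Proof. exact: chP. Qed.

Fact gen_square X Y (f : chmap X Y) (i j l : int) :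
  j = i + 1 -> l = j + 1 -> forall e,
  rmap (X j) e *m f j (tgt e) - f j (src e) *m rmap (Y j) e =
  cd X j l (src e) *m (0 : 'M_(X l (src e), Y j (tgt e))) +
  (0 : 'M_(X j (src e), Y i (tgt e))) *m cd Y i j (tgt e).
Proof. by move=> _ _ e; rewrite rhP mulmx0 mul0mx subrr addr0. Qed.

Definition coh_of X Y (f : chmap X Y) : coh X Y :=
  Coh (gen_chain f) (gen_square f).

Fact idmap_rhP (V : rep k Q) (e : arrow Q) :
  rmap V e *m 1%:M = 1%:M *m rmap V e.
Proof. by rewrite mulmx1 mul1mx. Qed.

Fact idmap_chP X i j a : 1%:M *m cd X i j a = cd X i j a *m 1%:M.
Proof. by rewrite mulmx1 mul1mx. Qed.

Definition chmap_id X : chmap X X :=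
  @ChMap _ _ _ X X (fun i => RHom (@idmap_rhP (X i))) (@idmap_chP X).

Section ChainMapComposition.
Variables (X Y Z : complex) (g : chmap Y Z) (f : chmap X Y).

Fact chmap_comp_rhP i e : rmap (X i) e *m (f i (tgt e) *m g i (tgt e)) =
  (f i (src e) *m g i (src e)) *m rmap (Z i) e.
Proof. by rewrite mulmxA rhP -mulmxA rhP mulmxA. Qed.

Fact chmap_comp_chP i j a :
  (f i a *m g i a) *m cd Z i j a = cd X i j a *m (f j a *m g j a).
Proof. by rewrite -mulmxA chP mulmxA chP mulmxA. Qed.

Definition chmap_comp : chmap X Z :=
  @ChMap _ _ _ X Z (fun i => RHom (chmap_comp_rhP i)) chmap_comp_chP.

End ChainMapComposition.

End CoherentMaps.

HB.instance Definition _ (k : fieldType) (Q0 : finType) (Q : quiver Q0)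
  (V X : complex k Q) := gen_eqMixin (coh V X).
HB.instance Definition _ (k : fieldType) (Q0 : finType) (Q : quiver Q0)
  (V X : complex k Q) := gen_choiceMixin (coh V X).

Section HomotopyCategory.
Variables (k : fieldType) (Q0 : finType) (Q : quiver Q0).
Notation complex := (complex k Q).
Implicit Types V X Y Z : complex.
Local Open Scope quotient_scope.

Section HomSpace.
Variables V X : complex.

Definition homotopicb : rel (coh V X) := fun p q => `[< homotopic p q >].

Fact homotopicb_equiv : equiv_class_of homotopicb.
Proof.
split=> [p|p q|p q r].
- by apply/asboolP; exact: homotopic_refl.
- by apply/asboolP/asboolP => ?; exact: homotopic_sym.
- move=> /asboolP pq /asboolP qr; apply/asboolP.
  exact: homotopic_trans pq qr.
Qed.

Canonical homotopicb_equiv_rel := EquivRelPack homotopicb_equiv.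

Definition hhom := {eq_quot homotopicb}.
HB.instance Definition _ := Choice.on hhom.

Definition cls (p : coh V X) : hhom := \pi_hhom p.

Lemma clsP (p q : coh V X) : homotopic p q <-> cls p = cls q.
Proof. by split=> [pq|/eqmodP/asboolP//]; apply/eqmodP/asboolP. Qed.

Lemma cls_eq (p q : coh V X) : coh_eq p q -> cls p = cls q.
Proof. by move=> pq; apply/clsP/coh_eq_homotopic. Qed.

Lemma clsK (u : hhom) : cls (repr u) = u.
Proof. exact: reprK. Qed.

Lemma homotopic_repr (p : coh V X) : homotopic (repr (cls p)) p.
Proof. by apply/clsP; rewrite clsK. Qed.

Definition hhom_comb c d (u v : hhom) := cls (coh_comb c d (repr u) (repr v)).
Definition hhom_add := hhom_comb 1 1.
Definition hhom_scale c (u : hhom) := hhom_comb c 0 u u.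
Definition hhom_opp := hhom_scale (-1).

Lemma hhom_combE c d p q :
  hhom_comb c d (cls p) (cls q) = cls (coh_comb c d p q).
Proof. by apply/clsP/homotopic_comb; exact: homotopic_repr. Qed.

Ltac hhom_axiom :=
  rewrite /hhom_opp /hhom_scale /hhom_add ?hhom_combE; apply: cls_eq; split=>
  [? ?|? ? ? _]; mxlin.

Fact hhom_addA : associative hhom_add.
Proof. by move=> u v w; rewrite -(clsK u) -(clsK v) -(clsK w); hhom_axiom. Qed.

Fact hhom_addC : commutative hhom_add.
Proof. by move=> u v; rewrite -(clsK u) -(clsK v); hhom_axiom. Qed.

Fact hhom_add0 : left_id (cls (coh_zero V X)) hhom_add.
Proof. by move=> u; rewrite -(clsK u); hhom_axiom. Qed.

Fact hhom_addN : left_inverse (cls (coh_zero V X)) hhom_opp hhom_add.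
Proof. by move=> u; rewrite -(clsK u); hhom_axiom. Qed.

HB.instance Definition _ := GRing.isZmodule.Build hhom
  hhom_addA hhom_addC hhom_add0 hhom_addN.

Lemma hhom_addE (u v : hhom) : u + v = hhom_add u v. Proof. by []. Qed.

Fact hhom_scaleA c d u : hhom_scale c (hhom_scale d u) = hhom_scale (c * d) u.
Proof. by rewrite -(clsK u); hhom_axiom. Qed.

Fact hhom_scale1 : left_id 1 hhom_scale.
Proof. by move=> u; rewrite -(clsK u); hhom_axiom. Qed.

Fact hhom_scaleDr : right_distributive hhom_scale +%R.
Proof.
move=> c u v; rewrite !hhom_addE -(clsK u) -(clsK v); hhom_axiom.
Qed.

Fact hhom_scaleDl u : {morph hhom_scale^~ u : c d / c + d}.
Proof. by move=> c d; rewrite hhom_addE -(clsK u); hhom_axiom. Qed.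

HB.instance Definition _ := GRing.Zmodule_isLmodule.Build k hhom
  hhom_scaleA hhom_scale1 hhom_scaleDr hhom_scaleDl.

Lemma cls_lin c p q : cls (coh_comb c 1 p q) = c *: cls p + cls q.
Proof.
rewrite hhom_addE [_ *: _]/(hhom_scale _ _) /hhom_scale /hhom_add !hhom_combE.
by apply: cls_eq; split=> [? ?|? ? ? _]; mxlin.
Qed.

Lemma cls0 : cls (coh_zero V X) = 0. Proof. by []. Qed.

End HomSpace.

Definition hcomp V X Y (v : hhom X Y) (u : hhom V X) : hhom V Y :=
  cls (coh_comp (repr v) (repr u)).

Lemma hcompE V X Y (q : coh X Y) (p : coh V X) :
  hcomp (cls q) (cls p) = cls (coh_comp q p).
Proof. by apply/clsP/homotopic_comp; exact: homotopic_repr. Qed.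

Definition hid X : hhom X X := cls (coh_of (chmap_id X)).

Fact hcomp_linl V X Y c (v v' : hhom X Y) (u : hhom V X) :
  hcomp (c *: v + v') u = c *: hcomp v u + hcomp v' u.
Proof.
rewrite -(clsK u) -(clsK v) -(clsK v') -cls_lin !hcompE -cls_lin.
by apply: cls_eq; split=> [i a|i j e _] /=; mxexpand; mxlin.
Qed.

Fact hcomp_linr V X Y c (v : hhom X Y) (u u' : hhom V X) :
  hcomp v (c *: u + u') = c *: hcomp v u + hcomp v u'.
Proof.
rewrite -(clsK u) -(clsK v) -(clsK u') -cls_lin !hcompE -cls_lin.
by apply: cls_eq; split=> [i a|i j e _] /=; mxexpand; mxlin.
Qed.

Fact hcomp_assoc V X Y Z (w : hhom Y Z) (v : hhom X Y) (u : hhom V X) :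
  hcomp w (hcomp v u) = hcomp (hcomp w v) u.
Proof.
rewrite -(clsK u) -(clsK v) -(clsK w) !hcompE.
by apply: cls_eq; split=> [i a|i j e _] /=; mxexpand; mxlin.
Qed.

Fact hcomp_idl V X (u : hhom V X) : hcomp (hid X) u = u.
Proof.
rewrite -(clsK u) hcompE; apply: cls_eq.
by split=> [i a|i j e _] /=; rewrite ?mulmx1 ?mulmx0 ?add0r.
Qed.

Fact hcomp_idr V X (u : hhom V X) : hcomp u (hid V) = u.
Proof.
rewrite -(clsK u) hcompE; apply: cls_eq.
by split=> [i a|i j e _] /=; rewrite ?mul1mx ?mul0mx ?addr0.
Qed.

Definition HH : lincat k :=
  LinCat hcomp_linl hcomp_linr hcomp_assoc hcomp_idl hcomp_idr.

Definition hmap X Y (f : chmap X Y) : @mor k HH X Y := cls (coh_of f).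

Lemma hmap_id X (f : chmap X X) :
  (forall i a, f i a = 1%:M) -> hmap f = idm (X : HH).
Proof. by move=> fE; apply: cls_eq; split. Qed.

Lemma hmap_comp X Y Z (g : chmap Y Z) (f : chmap X Y) (h : chmap X Z) :
  (forall i a, h i a = f i a *m g i a) -> hmap h = hmap g ∘ hmap f.
Proof.
move=> hE; rewrite /= hcompE; apply: cls_eq; split=> //= i j e _.
by rewrite mulmx0 mul0mx addr0.
Qed.

Lemma hmap_lin X Y c (f g h : chmap X Y) :
  (forall i a, h i a = c *: f i a + g i a) -> hmap h = c *: hmap f + hmap g.
Proof.
move=> hE; rewrite /hmap -cls_lin; apply: cls_eq; split=> /= [i a|i j e _].
  by rewrite hE scale1r.
by rewrite !scaler0 addr0.
Qed.

End HomotopyCategory.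

(** * Cylinders *)

Lemma addN_eq0 (G : zmodType) (x y : G) : - x + y = 0 -> y = x.
Proof. by move/eqP; rewrite addrC subr_eq0 => /eqP. Qed.

Lemma comp_linl0 (k : fieldType) (C : lincat k) (X Y Z : C) (f : mor X Y) :
  (0 : mor Y Z) ∘ f = 0.
Proof.
by have := comp_linl (-1) (0 : mor Y Z) 0 f;
  rewrite scaler0 addr0 scaleN1r addNr.
Qed.

Lemma comp_linr0 (k : fieldType) (C : lincat k) (X Y Z : C) (g : mor Y Z) :
  g ∘ (0 : mor X Y) = 0.
Proof.
by have := comp_linr (-1) g (0 : mor X Y) 0;
  rewrite scaler0 addr0 scaleN1r addNr.
Qed.

Ltac mxclean := rewrite ?(mul0mx, mulmx0, mulmx1, mul1mx, mulmxN, mulNmx,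
  opprK, oppr0, addr0, add0r, subr0, sub0r, row_mx0, col_mx0).

Section Extensions.
Variables (k : fieldType) (Q0 : finType) (Q : quiver Q0).
Notation complex := (complex k Q).
Notation HH := (HH k Q).
Implicit Types V W X Y Z : complex.

Lemma cshift1_cd V i j a : cd (cshift 1 V) i j a = - cd V (i + 1) (j + 1) a.
Proof. by rewrite /= /shift_mx expr1z scaleN1r. Qed.

Section Extension.
Variables A B : complex.
Variable theta : forall i j a, 'M[k]_(A i a, B j a).
Variable eta : forall i (e : arrow Q), 'M[k]_(A i (src e), B i (tgt e)).
Hypothesis theta_shape : forall i j, j <> i + 1 -> forall a, theta i j a = 0.
Hypothesis theta_cd : forall i j l, j = i + 1 -> l = j + 1 -> forall a,
  cd A i j a *m theta j l a + theta i j a *m cd B j l a = 0.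
Hypothesis theta_eta : forall i j, j = i + 1 -> forall e,
  rmap (A i) e *m theta i j (tgt e) + eta i e *m cd B i j (tgt e) =
  cd A i j (src e) *m eta j e + theta i j (src e) *m rmap (B j) e.

Definition ext_rep (i : int) : rep k Q :=
  @Rep _ _ _ (fun a => A i a + B i a)%N
    (fun e => block_mx (rmap (A i) e) (eta i e) 0 (rmap (B i) e)).

Definition ext_mx (i j : int) a : 'M_(ext_rep i a, ext_rep j a) :=
  block_mx (cd A i j a) (theta i j a) 0 (cd B i j a).

Fact ext_shape i j : j <> i + 1 -> forall a, ext_mx i j a = 0.
Proof. by move=> ij a; rewrite /ext_mx !cd_shape// theta_shape// block_mx0. Qed.

Fact ext_rhP i j e :
  rmap (ext_rep i) e *m ext_mx i j (tgt e) =
  ext_mx i j (src e) *m rmap (ext_rep j) e.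
Proof.
have [ji|/eqP ji] := eqVneq j (i + 1); last first.
  by rewrite !ext_shape// mulmx0 mul0mx.
rewrite /= !mulmx_block !(mul0mx, mulmx0, addr0, add0r) !rhP.
by rewrite theta_eta.
Qed.

Fact ext_dd i j l a : ext_mx i j a *m ext_mx j l a = 0.
Proof.
have [ji|/eqP ji] := eqVneq j (i + 1); last by rewrite ext_shape// mul0mx.
have [lj|/eqP lj] := eqVneq l (j + 1); last by rewrite (ext_shape lj) mulmx0.
rewrite /= !mulmx_block !(mul0mx, mulmx0, addr0, add0r) !cdd theta_cd//.
exact: block_mx0.
Qed.

Fact ext_bounded : exists N : nat, forall i : int, (N < `|i|)%N ->
  forall a, ext_rep i a = 0%N.
Proof.
have [N AN] := cx_bounded A; have [M BM] := cx_bounded B.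
by exists (N + M)%N => i iN a /=; rewrite AN ?BM//; lia.
Qed.

Definition ext : complex :=
  @Complex _ _ _ ext_rep (fun i j => RHom (ext_rhP i j))
    ext_shape ext_dd ext_bounded.

Fact ext_in_rhP i e :
  rmap (B i) e *m row_mx 0 1%:M = row_mx 0 1%:M *m rmap (ext i) e.
Proof.
by rewrite /= mul_mx_row mul_row_block !(mul0mx, mulmx0, mulmx1, mul1mx)
  !(addr0, add0r).
Qed.

Fact ext_in_chP i j a :
  row_mx 0 1%:M *m cd ext i j a = cd B i j a *m row_mx 0 1%:M.
Proof.
by rewrite /= mul_mx_row mul_row_block !(mul0mx, mulmx0, mulmx1, mul1mx)
  !(addr0, add0r).
Qed.

Definition ext_in : chmap B ext :=
  @ChMap _ _ _ B ext
    (fun i => @RHom _ _ _ (B i) (ext i) (fun a => row_mx 0 1%:M) (ext_in_rhP i))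
    ext_in_chP.

End Extension.

Section CoherentCone.
Variables (V X : complex) (p : coh V X).

(** The cone of a coherent map is a genuine complex of representations: the
    homotopies [coh_h] become the off-diagonal part of the action of the arrows. *)
Definition ccone_theta i j a : 'M[k]_(cshift 1 V i a, X j a) :=
  deg_id V (i + 1) j a *m coh_f p j a.

Definition ccone_eta i (e : arrow Q) :
    'M[k]_(cshift 1 V i (src e), X i (tgt e)) :=
  - coh_h p (i + 1) i e.

Fact ccone_shape i j : j <> i + 1 -> forall a, ccone_theta i j a = 0.
Proof. by move=> ji a; rewrite /ccone_theta deg_id0 ?mul0mx//; exact/nesym. Qed.

Fact ccone_cd i j l : j = i + 1 -> l = j + 1 -> forall a,
  cd (cshift 1 V) i j a *m ccone_theta j l a + ccone_theta i j a *m cd X j l a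
  = 0.
Proof.
move=> -> -> a; rewrite /ccone_theta !deg_id1 !mul1mx cshift1_cd.
by rewrite mulNmx (coh_chain p) addNr.
Qed.

Fact ccone_square i j : j = i + 1 -> forall e,
  rmap (cshift 1 V i) e *m ccone_theta i j (tgt e) +
  ccone_eta i e *m cd X i j (tgt e) =
  cd (cshift 1 V) i j (src e) *m ccone_eta j e +
  ccone_theta i j (src e) *m rmap (X j) e.
Proof.
move=> -> e; rewrite /ccone_theta /ccone_eta !deg_id1 !mul1mx cshift1_cd.
rewrite (@coh_rmapE _ _ _ _ _ p i _ (i + 1 + 1))//.
by mxexpand; mxlin.
Qed.

Definition ccone : complex := ext ccone_shape ccone_cd ccone_square.

(** The cylinder: degree [i] is [(V (i + 1) + X i) + V i] and
    [d (v', x, v) = (- d v', d x + p v', d v - v')]. *)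
Definition cyl_theta i j a : 'M[k]_(ccone i a, V j a) :=
  col_mx (- deg_id V (i + 1) j a) 0.

Definition cyl_eta i (e : arrow Q) : 'M[k]_(ccone i (src e), V i (tgt e)) := 0.

Fact cyl_shape i j : j <> i + 1 -> forall a, cyl_theta i j a = 0.
Proof.
move=> ji a; rewrite /cyl_theta deg_id0; last exact/nesym.
by rewrite oppr0 col_mx0.
Qed.

Fact cyl_cd i j l : j = i + 1 -> l = j + 1 -> forall a,
  cd ccone i j a *m cyl_theta j l a + cyl_theta i j a *m cd V j l a = 0.
Proof.
move=> -> -> a; rewrite /cyl_theta !deg_id1 mul_block_col mul_col_mx.
rewrite !(mul0mx, mulmx0, mulmxN, mulNmx, mulmx1, mul1mx) !addr0 add_col_mx.
by rewrite cshift1_cd opprK subrr addr0 col_mx0.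
Qed.

Fact cyl_square i j : j = i + 1 -> forall e,
  rmap (ccone i) e *m cyl_theta i j (tgt e) + cyl_eta i e *m cd V i j (tgt e) =
  cd ccone i j (src e) *m cyl_eta j e + cyl_theta i j (src e) *m rmap (V j) e.
Proof.
move=> -> e; rewrite /cyl_theta /cyl_eta !deg_id1 mul_block_col !mul_col_mx.
by mxclean.
Qed.

Definition cyl : complex := ext cyl_shape cyl_cd cyl_square.

Definition cyl_top : chmap V cyl := ext_in cyl_shape cyl_cd cyl_square.

Definition cyl_bot_mx i a : 'M[k]_(X i a, cyl i a) :=
  row_mx (row_mx 0 1%:M) 0.

Fact cyl_bot_rhP i e :
  rmap (X i) e *m cyl_bot_mx i (tgt e) = cyl_bot_mx i (src e) *m rmap (cyl i) e.
Proof.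
rewrite /cyl_bot_mx /= !mul_mx_row !mul_row_block.
by mxclean.
Qed.

Fact cyl_bot_chP i j a :
  cyl_bot_mx i a *m cd cyl i j a = cd X i j a *m cyl_bot_mx j a.
Proof.
rewrite /cyl_bot_mx /= !mul_mx_row !mul_row_block.
by rewrite mul_row_col; mxclean.
Qed.

Definition cyl_bot : chmap X cyl :=
  @ChMap _ _ _ X cyl
    (fun i => @RHom _ _ _ (X i) (cyl i) (cyl_bot_mx i) (cyl_bot_rhP i))
    cyl_bot_chP.

(** The null-homotopy [v |-> (v, 0, 0)]. *)
Lemma hmap_cyl_top : hmap cyl_top = (hmap cyl_bot : @mor k HH _ _) ∘ cls p.
Proof.
rewrite /= hcompE; apply/clsP/homotopic_sym.
exists (fun i h a => row_mx (row_mx (deg_id V i (h + 1) a) 0) 0 :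
          'M_(V i a, cyl h a)), (fun _ _ _ => 0).
split=> [i j l -> -> a|u i j l -> -> -> e].
  rewrite /boundary_f /= /ext_mx /= /cyl_bot_mx !deg_id1 /cyl_theta /ext_mx.
  rewrite !mul_mx_row !mul_row_block; mxclean.
  rewrite !(add_row_mx, opp_row_mx) mul_row_col; mxclean.
  rewrite cshift1_cd /ccone_theta !deg_id1.
  by mxclean; rewrite subrr.
rewrite /boundary_h /= /cyl_bot_mx !deg_id1 /ccone_eta /cyl_eta.
rewrite !mul_mx_row !mul_row_block; mxclean.
rewrite !(opp_row_mx, add_row_mx).
by mxclean; rewrite subrr; mxclean.
Qed.

Lemma cyl_bot_quasi_iso : quasi_iso cyl_bot.
Proof.
move=> h _ _ -> -> a; split=> [x xd|y].
  move=> /submxP[y]; rewrite -[y]hsubmxK -[lsubmx y]hsubmxK.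
  move: (lsubmx (lsubmx y)) (rsubmx (lsubmx y)) (rsubmx y) => v' x0 v.
  rewrite /= /cyl_bot_mx /ext_mx /= /ext_mx /cyl_theta /ccone_theta.
  rewrite !mul_mx_row !mul_row_block !mul_row_col.
  mxclean; rewrite !deg_id1.
  mxclean.
  move=> /eq_row_mx[/eq_row_mx[_ xE] /esym/addN_eq0 vE].
  rewrite xE -vE -mulmxA -(coh_chain p) mulmxA -mulmxDl.
  exact: submxMl.
rewrite -[y]hsubmxK -[lsubmx y]hsubmxK.
move: (lsubmx (lsubmx y)) (rsubmx (lsubmx y)) (rsubmx y) => v' x0 v.
rewrite /= /cyl_bot_mx /ext_mx /= /ext_mx /cyl_theta /ccone_theta.
rewrite !mul_row_block !mul_row_col.
mxclean; rewrite !deg_id1; mxclean.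
rewrite -row_mx0 => /eq_row_mx[].
rewrite -row_mx0 => /eq_row_mx[_ xd] /addN_eq0 vd.
exists (x0 + v *m coh_f p (h + 1) a); split.
  by rewrite mulmxDl -mulmxA (coh_chain p) mulmxA vd [LHS]addrC.
apply/submxP; exists (row_mx (row_mx (- v) 0) 0).
rewrite !mul_mx_row !mul_row_block !mul_row_col.
rewrite !(mul0mx, mulmx0, mulmx1, mul1mx) !(addr0, add0r).
rewrite !opp_row_mx !add_row_mx.
rewrite cshift1_cd mulmxN mulNmx opprK vd; mxclean.
by congr (row_mx (row_mx _ _) _); mxlin.
Qed.

End CoherentCone.
End Extensions.

Section CylinderMaps.
Variables (k : fieldType) (Q0 : finType) (Q : quiver Q0).
Notation complex := (complex k Q).
Implicit Types V W X Y Z : complex.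

Section CylinderMap.
Variables (V V' X X' : complex) (p : coh V X) (q : coh V' X').
Variables (u : chmap V V') (g : chmap X X').
Hypothesis pq : coh_eq (coh_comp (coh_of g) p) (coh_comp q (coh_of u)).

Let pq_f i a : coh_f p i a *m g i a = u i a *m coh_f q i a.
Proof. by case: pq => fE _; exact: fE. Qed.

Let pq_h i j e : i = j + 1 ->
  coh_h p i j e *m g j (tgt e) = u i (src e) *m coh_h q i j e.
Proof.
case: pq => _ hE ij; have := hE i j e ij.
by rewrite /= mulmx0 mul0mx add0r addr0.
Qed.

Definition cyl_map_mx i a : 'M[k]_(cyl p i a, cyl q i a) :=
  block_mx (block_mx (u (i + 1) a) 0 0 (g i a)) 0 0 (u i a).

Fact cyl_map_rhP i e : rmap (cyl p i) e *m cyl_map_mx i (tgt e) =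
  cyl_map_mx i (src e) *m rmap (cyl q i) e.
Proof.
rewrite /cyl_map_mx /= !mulmx_block; mxclean.
by rewrite /ccone_eta /cyl_eta; mxclean; rewrite pq_h// !rhP.
Qed.

Fact cyl_map_chP i j a :
  cyl_map_mx i a *m cd (cyl q) i j a = cd (cyl p) i j a *m cyl_map_mx j a.
Proof.
have [ji|/eqP ji] := eqVneq j (i + 1); last first.
  by rewrite !(cd_shape _ ji) mulmx0 mul0mx.
rewrite ji /cyl_map_mx /= /ext_mx /= /ext_mx /ccone_theta /cyl_theta !deg_id1.
rewrite !mulmx_block; mxclean; rewrite mul_block_col mul_col_mx; mxclean.
by rewrite !cshift1_cd; mxclean; rewrite !chP pq_f.
Qed.

Definition cyl_map : chmap (cyl p) (cyl q) :=
  @ChMap _ _ _ (cyl p) (cyl q)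
    (fun i => @RHom _ _ _ (cyl p i) (cyl q i) (cyl_map_mx i) (cyl_map_rhP i))
    cyl_map_chP.

Lemma cyl_map_top i a :
  cyl_top p i a *m cyl_map i a = u i a *m cyl_top q i a.
Proof.
by rewrite /= /cyl_map_mx mul_row_block mul_mx_row; mxclean.
Qed.

Lemma cyl_map_bot i a :
  cyl_bot p i a *m cyl_map i a = g i a *m cyl_bot q i a.
Proof.
rewrite /= /cyl_map_mx /cyl_bot_mx mul_row_block !mul_mx_row mul_row_block.
by mxclean.
Qed.

End CylinderMap.

Section CylinderOfChainMap.
Variables (X Y : complex) (f : chmap X Y).
Notation cylf := (cyl (coh_of f)).

Definition cyl_ret_mx i a : 'M[k]_(cylf i a, Y i a) :=
  col_mx (col_mx 0 1%:M) (f i a).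

Fact cyl_ret_rhP i e : rmap (cylf i) e *m cyl_ret_mx i (tgt e) =
  cyl_ret_mx i (src e) *m rmap (Y i) e.
Proof.
rewrite /cyl_ret_mx /= !mul_block_col !mul_col_mx.
by rewrite /ccone_eta /cyl_eta /=; mxclean; rewrite rhP.
Qed.

Fact cyl_ret_chP i j a :
  cyl_ret_mx i a *m cd Y i j a = cd cylf i j a *m cyl_ret_mx j a.
Proof.
have [ji|/eqP ji] := eqVneq j (i + 1); last first.
  by rewrite !(cd_shape _ ji) mulmx0 mul0mx.
rewrite ji /cyl_ret_mx /= /ext_mx /= /ext_mx /ccone_theta /cyl_theta !deg_id1.
rewrite !mul_block_col !mul_col_mx; mxclean.
by rewrite chP add_col_mx subrr; mxclean.
Qed.

Definition cyl_ret : chmap cylf Y :=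
  @ChMap _ _ _ cylf Y
    (fun i => @RHom _ _ _ (cylf i) (Y i) (cyl_ret_mx i) (cyl_ret_rhP i))
    cyl_ret_chP.

Lemma cyl_top_ret i a : cyl_top (coh_of f) i a *m cyl_ret i a = f i a.
Proof. by rewrite /= /cyl_ret_mx mul_row_col; mxclean. Qed.

Lemma cyl_bot_ret i a : cyl_bot (coh_of f) i a *m cyl_ret i a = 1%:M.
Proof.
by rewrite /= /cyl_bot_mx /cyl_ret_mx !mul_row_col; mxclean.
Qed.

Definition cyl_cone_mx i a : 'M[k]_(cylf i a, cone f i a) := col_mx 1%:M 0.

Fact cyl_cone_rhP i e : rmap (cylf i) e *m cyl_cone_mx i (tgt e) =
  cyl_cone_mx i (src e) *m rmap (cone f i) e.
Proof.
rewrite /cyl_cone_mx [LHS]mul_block_col [RHS]mul_col_mx.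
by rewrite /= /ccone_eta /cyl_eta /=; mxclean.
Qed.

Fact cyl_cone_chP i j a :
  cyl_cone_mx i a *m cd (cone f) i j a = cd cylf i j a *m cyl_cone_mx j a.
Proof.
rewrite /cyl_cone_mx [RHS]mul_block_col [LHS]mul_col_mx.
by mxclean; rewrite [RHS](congr1 (col_mx^~ 0) (_ : _ = cd (cone f) i j a))//=
  /ext_mx /cone_mx cshift1_cd.
Qed.

Definition cyl_cone : chmap cylf (cone f) :=
  @ChMap _ _ _ cylf (cone f)
    (fun i => @RHom _ _ _ (cylf i) (cone f i) (cyl_cone_mx i) (cyl_cone_rhP i))
    cyl_cone_chP.

Lemma cyl_bot_cone i a :
  cyl_bot (coh_of f) i a *m cyl_cone i a = cone_in f i a.
Proof. by rewrite /= /cyl_bot_mx /cyl_cone_mx mul_row_col; mxclean. Qed.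

End CylinderOfChainMap.

Definition degreewise_split (A B E : complex) (f : chmap B E) (g : chmap E A) :
    Prop :=
  exists (r : forall n a, 'M[k]_(E n a, B n a))
         (q : forall n a, 'M[k]_(A n a, E n a)),
  [/\ forall n e, rmap (E n) e *m r n (tgt e) = r n (src e) *m rmap (B n) e,
      forall n e, rmap (A n) e *m q n (tgt e) = q n (src e) *m rmap (E n) e,
      forall n a, f n a *m r n a = 1%:M,
      forall n a, q n a *m g n a = 1%:M &
      forall n a, g n a *m q n a + r n a *m f n a = 1%:M].

Lemma degreewise_split_shift n (A B E : complex) (f : chmap B E)
    (g : chmap E A) :
  degreewise_split f g -> degreewise_split (shift_chmap n f) (shift_chmap n g).
Proof.
move=> [r [q [rE qA fr qg gq]]].
by exists (fun i a => r (i + n) a), (fun i a => q (i + n) a); split=> i *;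
  rewrite /= ?rE ?qA ?fr ?qg ?gq.
Qed.

Lemma cyl_cone_split X Y (f : chmap X Y) :
  degreewise_split (cyl_top (coh_of f)) (cyl_cone f).
Proof.
exists (fun n a => col_mx 0 1%:M), (fun n a => row_mx 1%:M 0).
split=> [n e|n e|n a|n a|n a].
- by rewrite [LHS]mul_block_col [RHS]mul_col_mx /cyl_eta; mxclean.
- rewrite [LHS]mul_mx_row [RHS]mul_row_block /cyl_eta; mxclean.
  by congr (row_mx _ 0); rewrite /= /ccone_eta /= oppr0.
- by rewrite /= mul_row_col; mxclean.
- by rewrite /= /cyl_cone_mx mul_row_col; mxclean.
- rewrite /= /cyl_cone_mx !mul_col_mx !mul_mx_row; mxclean.
  by rewrite add_col_mx; mxclean; rewrite -block_mxEv -scalar_mx_block.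
Qed.

Lemma cone_split X Y (f : chmap X Y) :
  degreewise_split (cone_in f) (cone_out f).
Proof.
exists (fun n a => col_mx 0 1%:M), (fun n a => row_mx 1%:M 0).
split=> [n e|n e|n a|n a|n a].
- by rewrite [LHS]mul_block_col [RHS]mul_col_mx; mxclean.
- by rewrite [LHS]mul_mx_row [RHS]mul_row_block; mxclean.
- by rewrite /= mul_row_col; mxclean.
- by rewrite /= mul_row_col; mxclean.
- rewrite /= !mul_col_mx; mxclean.
  by rewrite add_col_mx; mxclean; rewrite -block_mxEv -scalar_mx_block.
Qed.

Section SubBoundary.
Variables (V X : complex) (p : coh V X).
Variable s : forall i j a, 'M[k]_(V i a, X j a).
Variable t : forall i j (e : arrow Q), 'M[k]_(V i (src e), X j (tgt e)).

Definition sub_boundary_f j a :=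
  coh_f p j a - boundary_f s (j - 1) j (j + 1) a.

Definition sub_boundary_h j i e :=
  coh_h p j i e - boundary_h s t (i - 1) i j (j + 1) e.

Lemma sub_boundary_fE i j l a : j = i + 1 -> l = j + 1 ->
  sub_boundary_f j a = coh_f p j a - boundary_f s i j l a.
Proof. by move=> -> ->; rewrite /sub_boundary_f addrK. Qed.

Lemma sub_boundary_hE u i j l e : i = u + 1 -> l = j + 1 ->
  sub_boundary_h j i e = coh_h p j i e - boundary_h s t u i j l e.
Proof. by move=> -> ->; rewrite /sub_boundary_h addrK. Qed.

Fact sub_boundary_chain i j a :
  sub_boundary_f i a *m cd X i j a = cd V i j a *m sub_boundary_f j a.
Proof.
have [ji|/eqP ji] := eqVneq j (i + 1); last first.
  by rewrite !(cd_shape _ ji) mulmx0 mul0mx.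
rewrite (@sub_boundary_fE (i - 1) i j) ?subrK//.
rewrite (@sub_boundary_fE i j (j + 1))// /boundary_f.
rewrite !(mulmxBl, mulmxBr, mulmxDl, mulmxDr) coh_chain; congr (_ - _).
rewrite !mulmxA cdd mul0mx add0r -[s i _ a *m _ *m _]mulmxA cdd mulmx0.
by rewrite addr0.
Qed.

Fact sub_boundary_square i j l : j = i + 1 -> l = j + 1 -> forall e,
  rmap (V j) e *m sub_boundary_f j (tgt e) -
  sub_boundary_f j (src e) *m rmap (X j) e =
  cd V j l (src e) *m sub_boundary_h l j e +
  sub_boundary_h j i e *m cd X i j (tgt e).
Proof.
move=> ji lj e; rewrite !(@sub_boundary_fE i j l)//.
rewrite (@sub_boundary_hE i j l (l + 1))//.
rewrite (@sub_boundary_hE (i - 1) i j l) ?subrK//.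
rewrite !(mulmxBl, mulmxBr).
transitivity ((rmap (V j) e *m coh_f p j (tgt e) -
    coh_f p j (src e) *m rmap (X j) e) -
    (rmap (V j) e *m boundary_f s i j l (tgt e) -
     boundary_f s i j l (src e) *m rmap (X j) e)); first by mxlin.
rewrite (coh_square p ji lj) /boundary_f /boundary_h.
rewrite !(mulmxDl, mulmxDr, mulmxN, mulNmx) !mulmxA.
rewrite !(cdd, mul0mx).
rewrite -[_ *m cd X (i - 1) i _ *m _]mulmxA cdd mulmx0.
rewrite -[s j i _ *m rmap _ e *m _]mulmxA (rhP (cd X i j)) !mulmxA.
rewrite (rhP (cd V j l)).
by mxlin.
Qed.

Definition sub_boundary : coh V X := Coh sub_boundary_chain sub_boundary_square.

Lemma homotopic_sub_boundary : homotopic p sub_boundary.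
Proof.
exists s, t; split=> [i j l ji lj a|u i j l iu ji lj e] /=.
  by rewrite (@sub_boundary_fE i j l)// subKr.
by rewrite (@sub_boundary_hE u i j l)// subKr.
Qed.

End SubBoundary.

Section SplitExact.
Variables (A B E : complex) (f : chmap B E) (g : chmap E A).
Hypothesis split_fg : degreewise_split f g.

Lemma coh_lift_split V (p : coh V E) :
  (forall i a, coh_f p i a *m g i a = 0) ->
  (forall i j e, i = j + 1 -> coh_h p i j e *m g j (tgt e) = 0) ->
  exists q : coh V B, coh_eq p (coh_comp (coh_of f) q).
Proof.
have [r [s [rE _ fr _ gs]]] := split_fg => pg hg.
have pE i a : coh_f p i a *m r i a *m f i a = coh_f p i a.
  by rewrite -[RHS]mulmx1 -(gs i a) mulmxDr !mulmxA pg mul0mx add0r.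
have hE i j e : i = j + 1 ->
    coh_h p i j e *m r j (tgt e) *m f j (tgt e) = coh_h p i j e.
  by move=> ij; rewrite -[RHS]mulmx1 -(gs j) mulmxDr !mulmxA hg// mul0mx add0r.
have fdr i j a : cd B i j a = f i a *m cd E i j a *m r j a.
  by rewrite chP -mulmxA fr mulmx1.
unshelve eexists (@Coh _ _ _ V B (fun i a => coh_f p i a *m r i a)
  (fun i j e => coh_h p i j e *m r j (tgt e)) _ _).
- by move=> i j a; rewrite fdr !mulmxA pE -coh_chain.
- move=> i j l ji lj e; rewrite fdr !mulmxA hE//.
  rewrite -[coh_f p j (src e) *m _ *m _]mulmxA -rE.
  rewrite -!mulmxDl -(coh_square p ji lj) !mulmxA -mulmxBl.
  by [].
split=> [i a|i j e ij] /=; first by rewrite pE.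
by rewrite mulmx0 add0r hE.
Qed.

Lemma hmap_split_exact V (x : @mor k (HH k Q) V E) :
  hmap g ∘ x = 0 -> exists y : @mor k (HH k Q) V B, x = hmap f ∘ y.
Proof.
have [r [q [_ qA _ qg _]]] := split_fg.
rewrite -[x]clsK; move: (repr _) => p; rewrite /= hcompE -cls0 => /clsP.
move=> [s [t [sE tE]]].
pose p' := @sub_boundary V E p (fun i j a => s i j a *m q j a)
  (fun i j e => t i j e *m q j (tgt e)).
have qdg i j a : q i a *m cd E i j a *m g j a = cd A i j a.
  by rewrite -mulmxA -chP mulmxA qg mul1mx.
have [||c p'c] := @coh_lift_split V p'.
- move=> i a; rewrite /= /sub_boundary_f mulmxBl.
  have := sE (i - 1) i _ (esym (subrK 1 i)) erefl a; rewrite /= subr0 => ->.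
  rewrite /boundary_f mulmxDl -!mulmxA qg mulmx1 [q _ _ *m _]mulmxA qdg.
  by rewrite subrr.
- move=> i j e ij; rewrite /= /sub_boundary_h mulmxBl.
  have := tE (j - 1) j i _ (esym (subrK 1 j)) ij erefl e.
  rewrite /= mulmx0 add0r subr0 => ->.
  rewrite /boundary_h !(mulmxDl, mulNmx) -!mulmxA.
  rewrite [q _ _ *m (cd _ _ _ _ *m _)]mulmxA.
  rewrite qdg qg mulmx1 [q _ _ *m _]mulmxA -qA -!mulmxA qg mulmx1.
  by rewrite mulmx1 subrr.
exists (cls c); rewrite hcompE; apply/clsP.
apply: homotopic_trans (homotopic_sub_boundary _ _ _) _.
exact: coh_eq_homotopic p'c.
Qed.

End SplitExact.

End CylinderMaps.

(** * Shifts and triangles *)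

Section Regrading.
Variables (k : fieldType) (Q0 : finType) (Q : quiver Q0).
Notation complex := (complex k Q).
Implicit Types X Y : complex.

Lemma deg_id_rmap X i j e : i = j ->
  rmap (X i) e *m deg_id X i j (tgt e) = deg_id X i j (src e) *m rmap (X j) e.
Proof. by move=> <-; rewrite !deg_id1 mulmx1 mul1mx. Qed.

Lemma deg_id_cd X i i' j j' a : i = i' -> j = j' ->
  deg_id X i i' a *m cd X i' j' a = cd X i j a *m deg_id X j j' a.
Proof. by move=> <- <-; rewrite !deg_id1 mulmx1 mul1mx. Qed.

Lemma deg_idK X i j a : i = j -> deg_id X i j a *m deg_id X j i a = 1%:M.
Proof. by move=> <-; rewrite !deg_id1 mulmx1. Qed.

Lemma deg_id_chmap X Y (f : chmap X Y) i j a : i = j ->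
  f i a *m deg_id Y i j a = deg_id X i j a *m f j a.
Proof. by move=> <-; rewrite !deg_id1 mulmx1 mul1mx. Qed.

Section Unshift.
Variable X : complex.

Fact unshift_chP i j a :
  deg_id X (i + 0) i a *m cd X i j a =
  cd (cshift 0 X) i j a *m deg_id X (j + 0) j a.
Proof.
by rewrite /= /shift_mx expr0z scale1r (deg_id_cd _ _ (addr0 i) (addr0 j)).
Qed.

Definition unshift : chmap (cshift 0 X) X :=
  @ChMap _ _ _ (cshift 0 X) X
    (fun i => @RHom _ _ _ (cshift 0 X i) (X i) (deg_id X (i + 0) i)
                    (fun e => deg_id_rmap X e (addr0 i)))
    unshift_chP.

Fact reshift_chP i j a :
  deg_id X i (i + 0) a *m cd (cshift 0 X) i j a =
  cd X i j a *m deg_id X j (j + 0) a.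
Proof.
rewrite /= /shift_mx expr0z scale1r.
by rewrite (deg_id_cd _ _ (esym (addr0 i)) (esym (addr0 j))).
Qed.

Definition reshift : chmap X (cshift 0 X) :=
  @ChMap _ _ _ X (cshift 0 X)
    (fun i => @RHom _ _ _ (X i) (cshift 0 X i) (deg_id X i (i + 0))
                    (fun e => deg_id_rmap X e (esym (addr0 i))))
    reshift_chP.

End Unshift.

Section ShiftShift.
Variables (m n l : int) (lmn : l = m + n).

Let shift_eq i : i + m + n = i + l.
Proof. by rewrite lmn addrA. Qed.

Let N1_neq0 : (-1 : k) != 0.
Proof. by rewrite oppr_eq0 oner_eq0. Qed.

Variable X : complex.

Lemma shift_shift_cd i j a : cd (cshift m (cshift n X)) i j a =
  (-1) ^ l *: cd X (i + m + n) (j + m + n) a.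
Proof. by rewrite /= /shift_mx /= /shift_mx scalerA lmn expfzDr. Qed.

Fact shift_merge_chP i j a :
  deg_id X (i + m + n) (i + l) a *m cd (cshift l X) i j a =
  cd (cshift m (cshift n X)) i j a *m deg_id X (j + m + n) (j + l) a.
Proof.
rewrite shift_shift_cd -scalemxAl -scalemxAr.
by rewrite (deg_id_cd _ _ (shift_eq i) (shift_eq j)).
Qed.

Definition shift_merge : chmap (cshift m (cshift n X)) (cshift l X) :=
  @ChMap _ _ _ (cshift m (cshift n X)) (cshift l X)
    (fun i => @RHom _ _ _ (cshift m (cshift n X) i) (cshift l X i)
                    (deg_id X (i + m + n) (i + l))
                    (fun e => deg_id_rmap X e (shift_eq i)))
    shift_merge_chP.

Fact shift_split_chP i j a :
  deg_id X (i + l) (i + m + n) a *m cd (cshift m (cshift n X)) i j a =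
  cd (cshift l X) i j a *m deg_id X (j + l) (j + m + n) a.
Proof.
rewrite shift_shift_cd -scalemxAl -scalemxAr.
by rewrite (deg_id_cd _ _ (esym (shift_eq i)) (esym (shift_eq j))).
Qed.

Definition shift_split : chmap (cshift l X) (cshift m (cshift n X)) :=
  @ChMap _ _ _ (cshift l X) (cshift m (cshift n X))
    (fun i => @RHom _ _ _ (cshift l X i) (cshift m (cshift n X) i)
                    (deg_id X (i + l) (i + m + n))
                    (fun e => deg_id_rmap X e (esym (shift_eq i))))
    shift_split_chP.

End ShiftShift.
End Regrading.

Section Triangles.
Variables (k : fieldType) (Q0 : finType) (Q : quiver Q0).
Notation complex := (complex k Q).
Implicit Types X Y Z : complex.

Definition exact_at (C : lincat k) (X Y Z : C) (f : mor X Y) (g : mor Y Z) :=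
  forall (V : C) (x : mor V Y), g ∘ x = 0 -> exists y, x = f ∘ y.

Section RotationMaps.
Variables (X Y : complex) (f : chmap X Y).
Notation cone2 := (cone (cone_in f)).

(** [x' |-> (- f x', x', 0)] embeds [X[1]] in the cone of [Y -> cone f], with
    retraction [rotate_out], so that exactness at [X[1]] reduces to exactness at
    that cone. *)
Definition rotate_in_mx i a : 'M[k]_(cshift 1 X i a, cone2 i a) :=
  row_mx (- f (i + 1) a) (row_mx 1%:M 0).

Fact rotate_in_rhP i e : rmap (cshift 1 X i) e *m rotate_in_mx i (tgt e) =
  rotate_in_mx i (src e) *m rmap (cone2 i) e.
Proof.
rewrite /rotate_in_mx /= !mul_mx_row !mul_row_block; mxclean.
by rewrite rhP.
Qed.

Fact rotate_in_chP i j a :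
  rotate_in_mx i a *m cd cone2 i j a =
  cd (cshift 1 X) i j a *m rotate_in_mx j a.
Proof.
have [ji|/eqP ji] := eqVneq j (i + 1); last first.
  by rewrite !(cd_shape _ ji) mulmx0 mul0mx.
rewrite ji cshift1_cd /rotate_in_mx /= /cone_mx /= /cone_mx !deg_id1 /=.
rewrite !mul_mx_row !mul_row_block; mxclean.
by rewrite mul_mx_row opp_row_mx add_row_mx; mxclean; rewrite addNr chP.
Qed.

Definition rotate_in : chmap (cshift 1 X) cone2 :=
  @ChMap _ _ _ (cshift 1 X) cone2
    (fun i => @RHom _ _ _ (cshift 1 X i) (cone2 i) (rotate_in_mx i)
                    (rotate_in_rhP i))
    rotate_in_chP.

Definition rotate_out_mx i a : 'M[k]_(cone2 i a, cshift 1 X i a) :=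
  col_mx 0 (col_mx 1%:M 0).

Fact rotate_out_rhP i e : rmap (cone2 i) e *m rotate_out_mx i (tgt e) =
  rotate_out_mx i (src e) *m rmap (cshift 1 X i) e.
Proof.
rewrite /rotate_out_mx [LHS]mul_block_col [RHS]mul_col_mx; mxclean.
by rewrite [X in col_mx _ X = _]mul_block_col mul_col_mx; mxclean.
Qed.

Fact rotate_out_chP i j a :
  rotate_out_mx i a *m cd (cshift 1 X) i j a =
  cd cone2 i j a *m rotate_out_mx j a.
Proof.
have [ji|/eqP ji] := eqVneq j (i + 1); last first.
  by rewrite !(cd_shape _ ji) mulmx0 mul0mx.
rewrite ji cshift1_cd /rotate_out_mx [RHS]mul_block_col [LHS]mul_col_mx.
rewrite !deg_id1 /= mul1mx mul_row_col /cone_mx mul_block_col !mul_col_mx.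
by mxclean.
Qed.

Definition rotate_out : chmap cone2 (cshift 1 X) :=
  @ChMap _ _ _ cone2 (cshift 1 X)
    (fun i => @RHom _ _ _ (cone2 i) (cshift 1 X i) (rotate_out_mx i)
                    (rotate_out_rhP i))
    rotate_out_chP.

Fact opp_chP i j a :
  - f i a *m cd Y i j a = cd X i j a *m - f j a.
Proof. by rewrite mulNmx mulmxN chP. Qed.

Fact opp_rhP i e :
  rmap (X i) e *m - f i (tgt e) = - f i (src e) *m rmap (Y i) e.
Proof. by rewrite mulNmx mulmxN rhP. Qed.

Definition opp_chmap : chmap X Y :=
  @ChMap _ _ _ X Y
    (fun i => @RHom _ _ _ (X i) (Y i) (fun a => - f i a) (opp_rhP i)) opp_chP.

End RotationMaps.

(** The hypotheses hold both for [hmap] and for [dmap] of the shifted maps. *)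
Section ConeTriangle.
Variables (C : lincat k) (F : complex -> C).
Variable M : forall X Y, chmap X Y -> mor (F X) (F Y).
Hypothesis M_id : forall X (f : chmap X X),
  (forall i a, f i a = 1%:M) -> M f = idm (F X).
Hypothesis M_comp : forall X Y Z (g : chmap Y Z) (f : chmap X Y)
    (h : chmap X Z),
  (forall i a, h i a = f i a *m g i a) -> M h = M g ∘ M f.
Hypothesis M_lin : forall X Y c (f g h : chmap X Y),
  (forall i a, h i a = c *: f i a + g i a) -> M h = c *: M f + M g.
Hypothesis M_cyl : forall X Y (f : chmap X Y),
  M (cyl_top (coh_of f)) = M (cyl_bot (coh_of f)) ∘ M f.
Hypothesis M_split : forall A B E (f : chmap B E) (g : chmap E A),
  degreewise_split f g -> exact_at (M f) (M g).

Lemma M_opp X Y (f : chmap X Y) : M (opp_chmap f) = - M f.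
Proof.
have -> : M (opp_chmap f) = (-2) *: M f + M f.
  by apply: M_lin => i a /=; mxlin.
by rewrite -{2}[M f]scale1r -scalerDl -scaleN1r; congr (_ *: _); ring.
Qed.

Variables (X Y : complex) (f : chmap X Y).

Lemma exact_cone_in : exact_at (M f) (M (cone_in f)).
Proof.
move=> V x xin.
have [|y yE] := M_split (cyl_cone_split f) (x := M (cyl_bot (coh_of f)) ∘ x).
  rewrite comp_assoc -(M_comp (h := cone_in f))// => i a.
  by rewrite cyl_bot_cone.
exists y; rewrite -[LHS]comp_idl -[RHS]comp_idl.
have <- : M (cyl_ret f) ∘ M (cyl_bot (coh_of f)) = idm (F Y).
  rewrite -(M_comp (h := chmap_id Y)) ?(M_id (f := chmap_id Y))// => i a.
  by rewrite cyl_bot_ret.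
by rewrite -!comp_assoc yE M_cyl -!comp_assoc.
Qed.

Lemma exact_cone_out : exact_at (M (cone_in f)) (M (cone_out f)).
Proof. exact/M_split/cone_split. Qed.

Lemma exact_cone_shift : exact_at (M (cone_out f)) (M (shift_chmap 1 f)).
Proof.
move=> V x xf.
have [|y yE] := M_split (cone_split (cone_in f)) (x := M (rotate_in f) ∘ x).
  rewrite comp_assoc -(M_comp (h := opp_chmap (shift_chmap 1 f))); last first.
    by move=> i a /=; rewrite /rotate_in_mx mul_row_col; mxclean.
  rewrite M_opp -scaleN1r -[_ *: _]addr0 comp_linl comp_linl0 addr0.
  by rewrite xf scaler0.
exists y; rewrite -[LHS]comp_idl.
have <- : M (rotate_out f) ∘ M (rotate_in f) = idm (F (cshift 1 X)).
  rewrite -(M_comp (h := chmap_id _)) ?(M_id (f := chmap_id _))// => i a.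
  by rewrite /= /rotate_in_mx /rotate_out_mx !mul_row_col; mxclean.
rewrite -comp_assoc yE comp_assoc; congr (_ ∘ _).
apply/esym/M_comp => i a.
by rewrite /= /rotate_out_mx mul_row_col; mxclean.
Qed.

End ConeTriangle.
End Triangles.

(** * Quasi-isomorphisms are invertible up to coherent homotopy *)

Section Whitehead.
Variables (k : fieldType) (Q0 : finType) (Q : quiver Q0).
Notation complex := (complex k Q).
Notation HH := (HH k Q).
Implicit Types V X Y Z : complex.

Definition acyclic Z : Prop := forall h i j, i = h + 1 -> j = i + 1 ->
  forall a (z : 'rV_(Z i a)), z *m cd Z i j a = 0 -> (z <= cd Z h i a)%MS.

Lemma cone_acyclic X Y (f : chmap X Y) : quasi_iso f -> acyclic (cone f).
Proof.
move=> fq h _ _ -> -> a z; rewrite -[z]hsubmxK.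
move: (lsubmx z) (rsubmx z) => x y.
rewrite [X in X = _ -> _]mul_row_block deg_id1 mul1mx mulmx0 addr0.
rewrite -row_mx0 => /eq_row_mx[]; rewrite mulmxN => /eqP.
rewrite oppr_eq0 => /eqP xd xy.
have [/(_ x xd) xinj _] := fq (h + 1) _ _ erefl erefl a.
have /xinj/submxP[x' xE] :
    (x *m f (h + 1 + 1)%R a <= cd Y (h + 1) (h + 1 + 1) a)%MS.
  by move/eqP: xy; rewrite addr_eq0 => /eqP ->; rewrite -mulNmx submxMl.
have [_ /(_ (x' *m f (h + 1) a + y))] := fq h _ _ erefl erefl a.
rewrite mulmxDl -mulmxA chP mulmxA -xE => /(_ xy).
move=> [x'' [x''d /submxP[y' y'E]]].
apply/submxP; exists (row_mx (x'' - x') y').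
rewrite [RHS]mul_row_block deg_id1 mul1mx mulmx0 addr0 mulmxN mulmxBl x''d -xE.
rewrite sub0r opprK; congr row_mx; rewrite -y'E mulmxBl.
by mxlin.
Qed.

(** [pinvmx d] is a section of [d] on its image, and [1 - d * pinvmx d] projects
    to the kernel of [d], that is, to the image of the preceding differential. *)
Definition contraction Z i h a : 'M[k]_(Z i a, Z h a) :=
  (1%:M - cd Z i (i + 1) a *m pinvmx (cd Z i (i + 1) a)) *m pinvmx (cd Z h i a).

Lemma contractionP Z : acyclic Z -> forall h i j, i = h + 1 -> j = i + 1 ->
  forall a, cd Z i j a *m contraction Z j i a +
            contraction Z i h a *m cd Z h i a = 1%:M.
Proof.
move=> Zac h i j ih ji a; rewrite /contraction -ji.
rewrite mulmxA mulmxBr mulmx1 [cd Z i j a *m (_ *m _)]mulmxA cdd mul0mx subr0.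
rewrite mulmxKpV; first by rewrite [LHS]addrC subrK.
apply/row_subP => r.
apply: (Zac h i j ih ji a); rewrite -row_mul mulmxBl mul1mx mulmxKpV//.
by rewrite subrr row0.
Qed.

Lemma hhom_acyclic0 V Z (x : @mor k HH V Z) : acyclic Z -> x = 0.
Proof.
move=> Zac; rewrite -[x]clsK; move: (repr _) => p.
have [c cP] : exists c : forall i h a, 'M[k]_(Z i a, Z h a),
    forall h i j a, i = h + 1 -> j = i + 1 ->
    cd Z i j a *m c j i a + c i h a *m cd Z h i a = 1%:M.
  by exists (contraction Z) => h i j a ih ji; exact: contractionP.
pose p' := @sub_boundary k Q0 Q V Z p (fun i j a => coh_f p i a *m c i j a)
  (fun _ _ _ => 0).
have p'f i a : coh_f p' i a = 0.
  rewrite /= /sub_boundary_f /boundary_f mulmxA -coh_chain -!mulmxA -mulmxDr.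
  by rewrite cP ?mulmx1 ?subrr// subrK.
have -> : cls p = cls p'.
  by apply/clsP; exact: homotopic_sub_boundary.
rewrite -cls0; apply/clsP.
exists (fun _ _ _ => 0),
  (fun l i e => - (coh_h p' l (i + 1) e *m c (i + 1) i (tgt e))).
split=> [i j l ji lj a|u i j l iu ji lj e].
  by rewrite p'f /boundary_f; mxclean.
rewrite /boundary_h [coh_h (coh_zero _ _) _ _ _]/= -iu -ji; mxclean.
have /esym := coh_square p' ji lj e; rewrite !p'f; mxclean => hd.
rewrite -[LHS]mulmx1 -(cP u i j)// mulmxDr !mulmxA.
by move/eqP: hd; rewrite addrC addr_eq0 => /eqP ->; rewrite mulNmx.
Qed.

Definition hmap_exact A B E (f : chmap B E) (g : chmap E A) :
    degreewise_split f g -> exact_at (hmap f : @mor k HH _ _) (hmap g) :=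
  fun fg => hmap_split_exact fg.

Definition hmap_cyl X Y (f : chmap X Y) :
  hmap (cyl_top (coh_of f)) = hmap (cyl_bot (coh_of f)) ∘ hmap f :=
  hmap_cyl_top (coh_of f).

Lemma hmap_quasi_iso_sectionable X Y (s : chmap X Y) : quasi_iso s ->
  exists g : @mor k HH Y X, hmap s ∘ g = idm (Y : HH).
Proof.
move=> sq.
have [|g gE] := exact_cone_in (@hmap_id k Q0 Q) (@hmap_comp k Q0 Q) hmap_cyl
  hmap_exact (f := s) (x := idm (Y : HH)).
  by apply: hhom_acyclic0; exact: cone_acyclic.
by exists g.
Qed.

Lemma hmap_shift_quasi_iso X Y (s : chmap X Y) : quasi_iso s ->
  is_iso (hmap (shift_chmap 1 s)).
Proof.
move=> sq; have [g sg] := hmap_quasi_iso_sectionable (shift_quasi_iso 1 sq).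
exists g; split=> //; apply/eqP; rewrite -subr_eq0; apply/eqP.
have [|y ->] := exact_cone_shift (@hmap_id k Q0 Q) (@hmap_comp k Q0 Q)
    (@hmap_lin k Q0 Q) hmap_exact (f := s)
    (x := g ∘ hmap (shift_chmap 1 s) - idm (_ : HH)).
  rewrite addrC -scaleN1r comp_linr comp_assoc sg comp_idl comp_idr.
  by rewrite scaleN1r addNr.
by rewrite (hhom_acyclic0 y (cone_acyclic sq)) comp_linr0.
Qed.

End Whitehead.

Section IsoFacts.
Variables (k : fieldType) (C : lincat k).
Implicit Types X Y Z : C.

Lemma is_iso_comp X Y Z (g : mor Y Z) (f : mor X Y) :
  is_iso g -> is_iso f -> is_iso (g ∘ f).
Proof.
move=> [g' [g'g gg']] [f' [f'f ff']]; exists (f' ∘ g'); split.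
  by rewrite comp_assoc -[f' ∘ g' ∘ g]comp_assoc g'g comp_idr.
by rewrite comp_assoc -[g ∘ f ∘ f']comp_assoc ff' comp_idr.
Qed.

Lemma iso_square X Y X' Y' (f : mor X Y) (f' : mor X' Y') (a : mor X X')
    (b : mor Y Y') :
  is_iso a -> is_iso b -> is_iso f -> f' ∘ a = b ∘ f -> is_iso f'.
Proof.
move=> [a' [a'a aa']] biso fiso comm.
have -> : f' = (b ∘ f) ∘ a' by rewrite -comm -comp_assoc aa' comp_idr.
by apply: is_iso_comp; [exact: is_iso_comp | exists a].
Qed.

End IsoFacts.

Section Regrade.
Variables (k : fieldType) (Q0 : finType) (Q : quiver Q0).
Notation complex := (complex k Q).
Variables (C : lincat k) (F : complex -> C).
Variable M : forall X Y : complex, chmap X Y -> mor (F X) (F Y).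
Hypothesis M_id : forall X (f : chmap X X),
  (forall i a, f i a = 1%:M) -> M f = idm (F X).
Hypothesis M_comp : forall X Y Z (g : chmap Y Z) (f : chmap X Y)
    (h : chmap X Z),
  (forall i a, h i a = f i a *m g i a) -> M h = M g ∘ M f.

Lemma M_iso X Y (f : chmap X Y) (g : chmap Y X) :
  (forall i a, f i a *m g i a = 1%:M) -> (forall i a, g i a *m f i a = 1%:M) ->
  is_iso (M f).
Proof.
move=> fg gf; exists (M g); split.
  by rewrite -(M_comp (h := chmap_id X)) ?(M_id (f := chmap_id X)).
by rewrite -(M_comp (h := chmap_id Y)) ?(M_id (f := chmap_id Y)).
Qed.

Lemma unshift_iso X : is_iso (M (unshift X)).
Proof.
apply: (M_iso (g := reshift X)) => i a.
  exact: (deg_idK X a (addr0 i)).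
exact: (deg_idK X a (esym (addr0 i))).
Qed.

Lemma shift_merge_iso m n l (lmn : l = m + n) X :
  is_iso (M (shift_merge lmn X)).
Proof.
have eqi i : i + m + n = i + l by rewrite lmn addrA.
apply: (M_iso (g := shift_split lmn X)) => i a.
  exact: (deg_idK X a (eqi i)).
exact: (deg_idK X a (esym (eqi i))).
Qed.

Lemma unshift_natural X Y (f : chmap X Y) :
  M f ∘ M (unshift X) = M (unshift Y) ∘ M (shift_chmap 0 f).
Proof.
have h i a :
    f (i + 0) a *m deg_id Y (i + 0) i a = deg_id X (i + 0) i a *m f i a.
  by apply: deg_id_chmap; rewrite addr0.
pose u := chmap_comp f (unshift X).
rewrite -(M_comp (h := u))// -(M_comp (h := u))// => i a /=.
by rewrite h.
Qed.

Lemma shift_merge_natural m n l (lmn : l = m + n) X Y (f : chmap X Y) :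
  M (shift_chmap l f) ∘ M (shift_merge lmn X) =
  M (shift_merge lmn Y) ∘ M (shift_chmap m (shift_chmap n f)).
Proof.
have h i a : f (i + m + n) a *m deg_id Y (i + m + n) (i + l) a =
    deg_id X (i + m + n) (i + l) a *m f (i + l) a.
  by apply: deg_id_chmap; rewrite lmn addrA.
pose u := chmap_comp (shift_chmap l f) (shift_merge lmn X).
rewrite -(M_comp (h := u))// -(M_comp (h := u))// => i a /=.
by rewrite h.
Qed.

End Regrade.

(** [hmap_shift_quasi_iso] only treats shifts [s[1]], and [s] is isomorphic to
    [s[-1][1]]. *)
Lemma hmap_quasi_iso (k : fieldType) (Q0 : finType) (Q : quiver Q0)
    (X Y : complex k Q) (s : chmap X Y) : quasi_iso s -> is_iso (hmap s).
Proof.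
move=> sq.
have e0 : (0 : int) = 1 + -1 by rewrite subrr.
have s1 : is_iso (hmap (shift_chmap 1 (shift_chmap (-1) s))).
  exact/hmap_shift_quasi_iso/shift_quasi_iso.
have s0 : is_iso (hmap (shift_chmap 0 s)).
  apply: (iso_square _ _ s1 (shift_merge_natural (@hmap_comp k Q0 Q) e0 s)).
  - exact: (shift_merge_iso (@hmap_id k Q0 Q) (@hmap_comp k Q0 Q)).
  - exact: (shift_merge_iso (@hmap_id k Q0 Q) (@hmap_comp k Q0 Q)).
apply: (iso_square _ _ s0 (unshift_natural (@hmap_comp k Q0 Q) s)).
- exact: (unshift_iso (@hmap_id k Q0 Q) (@hmap_comp k Q0 Q)).
- exact: (unshift_iso (@hmap_id k Q0 Q) (@hmap_comp k Q0 Q)).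
Qed.

(** * Comparison with the derived category *)

Section Comparison.
Variables (k : fieldType) (Q0 : finType) (Q : quiver Q0).
Notation complex := (complex k Q).
Notation HH := (HH k Q).
Notation Db := (Db k Q).
Implicit Types V W X Y Z : complex.

Definition theta V X (p : coh V X) : @mor k Db V X :=
  dinv (cyl_bot_quasi_iso p) ∘ dmap (cyl_top p).

Lemma dmap_cancel X Y (s : chmap X Y) (hs : quasi_iso s) (W : Db)
    (x y : @mor k Db W X) : dmap s ∘ x = dmap s ∘ y -> x = y.
Proof.
by move=> xy; rewrite -[x]comp_idl -[y]comp_idl -(dinvl hs) -!comp_assoc xy.
Qed.

Lemma thetaP V X (p : coh V X) :
  dmap (cyl_bot p) ∘ theta p = dmap (cyl_top p).
Proof. by rewrite /theta comp_assoc dinvr comp_idl. Qed.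

Lemma theta_natural V V' X X' (p : coh V X) (q : coh V' X') (u : chmap V V')
    (g : chmap X X') :
  coh_eq (coh_comp (coh_of g) p) (coh_comp q (coh_of u)) ->
  theta q ∘ dmap u = dmap g ∘ theta p.
Proof.
move=> pq; apply: (dmap_cancel (cyl_bot_quasi_iso q)).
have top : dmap (cyl_map pq) ∘ dmap (cyl_top p) = dmap (cyl_top q) ∘ dmap u.
  pose h := chmap_comp (cyl_top q) u.
  rewrite -(dmap_comp (h := h)) -?(dmap_comp (h := h))// => i a.
  by rewrite cyl_map_top.
have bot : dmap (cyl_map pq) ∘ dmap (cyl_bot p) = dmap (cyl_bot q) ∘ dmap g.
  pose h := chmap_comp (cyl_bot q) g.
  rewrite -(dmap_comp (h := h)) -?(dmap_comp (h := h))// => i a.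
  by rewrite cyl_map_bot.
rewrite [LHS]comp_assoc [RHS]comp_assoc thetaP -bot.
by rewrite -[RHS]comp_assoc thetaP top.
Qed.

Lemma theta_coh_of X Y (f : chmap X Y) : theta (coh_of f) = dmap f.
Proof.
have retbot : dmap (cyl_ret f) ∘ dmap (cyl_bot (coh_of f)) = idm (Y : Db).
  rewrite -(dmap_comp (h := chmap_id Y)) ?(dmap_id (f := chmap_id Y))// => i a.
  by rewrite cyl_bot_ret.
rewrite -[LHS]comp_idl -retbot -comp_assoc thetaP.
by apply/esym/dmap_comp => i a; rewrite cyl_top_ret.
Qed.

Lemma dmap_cyl X Y (f : chmap X Y) :
  dmap (cyl_top (coh_of f)) = dmap (cyl_bot (coh_of f)) ∘ dmap f.
Proof. by rewrite -thetaP theta_coh_of. Qed.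

Section HomotopyInvariance.
Variables (V X : complex) (p q : coh V X).
Variable s : forall i j a, 'M[k]_(V i a, X j a).
Variable t : forall i j (e : arrow Q), 'M[k]_(V i (src e), X j (tgt e)).
Hypothesis sE : forall i j l, j = i + 1 -> l = j + 1 -> forall a,
  coh_f p j a - coh_f q j a = boundary_f s i j l a.
Hypothesis tE : forall u i j l, i = u + 1 -> j = i + 1 -> l = j + 1 ->
  forall e, coh_h p j i e - coh_h q j i e = boundary_h s t u i j l e.
Notation cylV := (cyl (coh_of (chmap_id V))).

Definition homotopy_f i a : 'M[k]_(cylV i a, X i a) :=
  col_mx (col_mx (s (i + 1) i a) (coh_f p i a)) (coh_f q i a).

Definition homotopy_h i j e : 'M[k]_(cylV i (src e), X j (tgt e)) :=
  col_mx (col_mx (t (i + 1) j e) (coh_h p i j e)) (coh_h q i j e).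

Fact homotopy_chain i j a :
  homotopy_f i a *m cd X i j a = cd cylV i j a *m homotopy_f j a.
Proof.
have [ji|/eqP ji] := eqVneq j (i + 1); last first.
  by rewrite !(cd_shape _ ji) mulmx0 mul0mx.
rewrite ji /homotopy_f /= /ext_mx /= /ext_mx /ccone_theta /cyl_theta !deg_id1.
rewrite !mul_block_col !mul_col_mx; mxclean.
rewrite add_col_mx cshift1_cd (coh_chain p) (coh_chain q); mxclean.
congr (col_mx (col_mx _ _) _).
have := sE erefl erefl a (i := i); rewrite /boundary_f => /eqP.
rewrite subr_eq => /eqP ->; mxlin.
Qed.

Fact homotopy_square i j l : j = i + 1 -> l = j + 1 -> forall e,
  rmap (cylV j) e *m homotopy_f j (tgt e) -
  homotopy_f j (src e) *m rmap (X j) e =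
  cd cylV j l (src e) *m homotopy_h l j e +
  homotopy_h j i e *m cd X i j (tgt e).
Proof.
move=> ji -> e.
rewrite /homotopy_f /homotopy_h /= /ext_mx /= /ext_mx /ccone_theta /cyl_theta.
rewrite /ccone_eta /cyl_eta /= !deg_id1.
rewrite !mul_block_col !mul_col_mx; mxclean.
rewrite !(add_col_mx, opp_col_mx) /shift_mx expr1z scaleN1r; mxclean.
congr (col_mx (col_mx _ _) _); [|exact: coh_square|exact: coh_square].
have := tE ji erefl erefl e; rewrite /boundary_h => /eqP.
rewrite subr_eq => /eqP ->; mxlin.
Qed.

(** A homotopy between [p] and [q] is a coherent map from the cylinder of the
    identity, and the two ends of that cylinder agree in [Db]. *)
Definition homotopy_coh : coh cylV X := Coh homotopy_chain homotopy_square.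

Lemma theta_homotopy : theta p = theta q.
Proof.
have top : theta q = theta homotopy_coh ∘ dmap (cyl_top (coh_of (chmap_id V))).
  rewrite (@theta_natural _ _ _ _ q _ _ (chmap_id X)).
    by rewrite (dmap_id (f := chmap_id X))// comp_idl.
  split=> [i a|i j e _] /=; first by rewrite /homotopy_f mul_row_col; mxclean.
  by rewrite /homotopy_h mul_row_col; mxclean.
have bot : theta p = theta homotopy_coh ∘ dmap (cyl_bot (coh_of (chmap_id V))).
  rewrite (@theta_natural _ _ _ _ p _ _ (chmap_id X)).
    by rewrite (dmap_id (f := chmap_id X))// comp_idl.
  split=> [i a|i j e _] /=.
    by rewrite /homotopy_f /cyl_bot_mx !mul_row_col; mxclean.
  by rewrite /homotopy_h /cyl_bot_mx !mul_row_col; mxclean.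
by rewrite top dmap_cyl (dmap_id (f := chmap_id V))// comp_idr.
Qed.

End HomotopyInvariance.

Lemma theta_homotopic V X (p q : coh V X) : homotopic p q -> theta p = theta q.
Proof. by move=> [s [t [sE tE]]]; exact: theta_homotopy sE tE. Qed.

Section Linearity.
Variables (V X : complex) (p q : coh V X).
Notation XX := (dsum X X : complex).

Fact coh_pair_chain i j a :
  (row_mx (coh_f p i a) (coh_f q i a) : 'M_(_, XX i a)) *m cd XX i j a =
  cd V i j a *m row_mx (coh_f p j a) (coh_f q j a).
Proof. by rewrite mul_row_block mul_mx_row !coh_chain; mxclean. Qed.

Fact coh_pair_square i j l : j = i + 1 -> l = j + 1 -> forall e,
  rmap (V j) e *m
    (row_mx (coh_f p j (tgt e)) (coh_f q j (tgt e)) : 'M_(_, XX j (tgt e))) -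
  row_mx (coh_f p j (src e)) (coh_f q j (src e)) *m rmap (XX j) e =
  cd V j l (src e) *m row_mx (coh_h p l j e) (coh_h q l j e) +
  row_mx (coh_h p j i e) (coh_h q j i e) *m cd XX i j (tgt e).
Proof.
move=> ji lj e; rewrite !mul_row_block !mul_mx_row; mxclean.
by rewrite opp_row_mx !add_row_mx !(@coh_square _ _ _ _ _ _ i j l).
Qed.

Definition coh_pair : coh V XX := Coh coh_pair_chain coh_pair_square.

Definition fold_mx c d i a : 'M[k]_(XX i a, X i a) := col_mx c%:M d%:M.

Fact fold_rhP c d i e : rmap (XX i) e *m fold_mx c d i (tgt e) =
  fold_mx c d i (src e) *m rmap (X i) e.
Proof.
rewrite /fold_mx [LHS]mul_block_col mul_col_mx; mxclean.
by rewrite !scalar_mxC.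
Qed.

Fact fold_chP c d i j a :
  fold_mx c d i a *m cd X i j a = cd XX i j a *m fold_mx c d j a.
Proof.
rewrite /fold_mx [RHS]mul_block_col mul_col_mx; mxclean.
by rewrite !scalar_mxC.
Qed.

Definition fold c d : chmap XX X :=
  @ChMap _ _ _ XX X
    (fun i => @RHom _ _ _ (XX i) (X i) (fold_mx c d i) (fold_rhP c d i))
    (fold_chP c d).

(** Additivity of [theta] follows from naturality with respect to
    [X + X -> X, (x, y) |-> c x + d y]. *)
Lemma theta_comb c d :
  theta (coh_comb c d p q) = dmap (fold c d) ∘ theta coh_pair.
Proof.
rewrite -(@theta_natural V V XX X coh_pair (coh_comb c d p q) (chmap_id V)).
  by rewrite (dmap_id (f := chmap_id V))// comp_idr.
split=> [i a|i j e _] /=.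
  by rewrite /fold_mx mul_row_col mul1mx !mul_mx_scalar.
by rewrite /fold_mx mul_row_col; mxclean; rewrite !mul_mx_scalar.
Qed.

End Linearity.

Lemma theta_linear V X c (p q : coh V X) :
  theta (coh_comb c 1 p q) = c *: theta p + theta q.
Proof.
rewrite theta_comb (dmap_lin (f := fold X 1 0) (g := fold X 0 1) (c := c)).
  rewrite comp_linl -!theta_comb; congr (_ *: _ + _); apply: theta_homotopic;
  by apply: coh_eq_homotopic; split=> [i a|i j e _]; mxlin.
move=> i a /=; rewrite /fold_mx scale_col_mx add_col_mx.
by congr col_mx; rewrite scale_scalar_mx -raddfD /= ?mulr1 ?mulr0 ?addr0 ?add0r.
Qed.

Definition thetaq V X (x : @mor k HH V X) : @mor k Db V X :=
  theta (repr (x : hhom V X)).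

Lemma thetaqE V X (p : coh V X) : thetaq (cls p) = theta p.
Proof. exact/theta_homotopic/homotopic_repr. Qed.

Lemma thetaq_linear V X : linear (@thetaq V X).
Proof.
move=> c x y; rewrite -[x]clsK -[y]clsK -cls_lin !thetaqE.
exact: theta_linear.
Qed.

Definition phi_gen X Y (g : dgen X Y) : @mor k HH X Y :=
  match g with
  | DMap f => hmap f
  | DInv s hs => sval (cid (hmap_quasi_iso hs))
  end.

Fact phi_gen_rel X Y (f g : expr k (@dgen k Q0 Q) X Y) : drel f g ->
  eval (C := HH) (F0 := fun X => X) phi_gen f = eval phi_gen g.
Proof.
move=> fg; case: {X Y} f g / fg => [X f fE|X Y Z g f h hE|X Y c f g h hE|
                                    X Y s hs|X Y s hs] /=.
- by apply: hmap_id.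
- exact: hmap_comp.
- exact: hmap_lin.
- by case: cid => g [].
- by case: cid => g [].
Qed.

Definition phi : linfunctor Db HH := extension phi_gen_rel.

Lemma phi_dmap X Y (f : chmap X Y) : fmor phi (dmap f) = hmap f.
Proof. exact: (ext_morE phi_gen_rel (emap f)). Qed.

Lemma thetaq_dmap V X Y (f : chmap X Y) (x : @mor k HH V X) :
  thetaq (hmap f ∘ x) = dmap f ∘ thetaq x.
Proof.
rewrite -[x]clsK; move: (repr _) => p; rewrite thetaqE.
rewrite -[hmap f ∘ _]/(hcomp (cls (coh_of f)) (cls p)) hcompE thetaqE.
rewrite -(@theta_natural V V X Y p (coh_comp (coh_of f) p) (chmap_id V)).
  by rewrite (dmap_id (f := chmap_id V))// comp_idr.
by split=> [i a|i j e _] /=; mxclean.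
Qed.

Lemma thetaq_phi X Y (e : expr k (@dgen k Q0 Q) X Y) V (x : @mor k HH V X) :
  thetaq ((eval (C := HH) (F0 := fun X => X) phi_gen e : @mor k HH X Y) ∘ x) =
  (pclass (@drel k Q0 Q) e : @mor k Db X Y) ∘ thetaq x.
Proof.
elim: {X Y} e V x => [X Y [f|s hs]|X|X Y Z g IHg f IHf|X Y|X Y f IHf g IHg|
    X Y c f IHf] V x.
- exact: thetaq_dmap.
- rewrite -[eval _ _]/(sval (cid (hmap_quasi_iso hs))).
  case: cid => g [gs sg]; rewrite -[sval _]/g; apply: (dmap_cancel hs).
  rewrite -thetaq_dmap -[pclass _ _]/(dinv hs) [RHS]comp_assoc dinvr comp_idl.
  by rewrite comp_assoc sg comp_idl.
- rewrite -[eval _ _]/(idm (X : HH)) -[pclass _ _]/(idm (X : Db)).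
  by rewrite !comp_idl.
- have -> : pclass (@drel k Q0 Q) (EComp g f) =
      (pclass (@drel k Q0 Q) g : @mor k Db Y Z) ∘ pclass (@drel k Q0 Q) f.
    by rewrite /= pcompE.
  rewrite -[eval _ (EComp g f)]/(eval phi_gen g ∘ eval phi_gen f).
  by rewrite -[RHS]comp_assoc -IHf -IHg comp_assoc.
- rewrite -[eval _ _]/(0 : @mor k HH X Y) -[pclass _ _]/(0 : @mor k Db X Y).
  by rewrite !comp_linl0; exact/lin_fun0/thetaq_linear.
- rewrite pclassD -[eval _ _]/(eval phi_gen f + eval phi_gen g).
  rewrite -[eval phi_gen f]scale1r comp_linl thetaq_linear IHf IHg.
  by rewrite -[in RHS](scale1r (pclass _ f)) comp_linl.
- rewrite pclassZ -[eval _ _]/(c *: eval phi_gen f).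
  rewrite -[c *: eval _ _]addr0 -[c *: pclass _ _]addr0 !comp_linl.
  by rewrite !comp_linl0 !addr0 lin_funZ ?IHf//; exact: thetaq_linear.
Qed.

Lemma thetaqK V X (x : @mor k Db V X) : thetaq (fmor phi x) = x.
Proof.
rewrite -[fmor phi x]comp_idr -[in RHS](pclassK x).
rewrite [LHS]thetaq_phi -[idm _]/(cls _) thetaqE theta_coh_of.
by rewrite dmap_id// comp_idr.
Qed.

Lemma phi_theta V X (p : coh V X) : fmor phi (theta p) = cls p.
Proof.
have := fmor_comp phi (dinv (cyl_bot_quasi_iso p)) (dmap (cyl_bot p)).
rewrite dinvl fmor_id phi_dmap => inv_bot.
rewrite [LHS]fmor_comp phi_dmap hmap_cyl_top [LHS]comp_assoc.
by rewrite -inv_bot [LHS](comp_idl (cls p : @mor k HH V X)).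
Qed.

Lemma phi_bij V X : bijective (@fmor k Db HH phi V X).
Proof.
exists (@thetaq V X) => x; first exact: thetaqK.
by rewrite -[x in RHS]clsK -phi_theta.
Qed.

End Comparison.

(** * Exact sequences in the derived category *)

Lemma fmor0 (k : fieldType) (C D : lincat k) (F : linfunctor C D) (X Y : C) :
  fmor F (0 : mor X Y) = 0.
Proof.
by have := fmor_lin F (-1) (0 : mor X Y) 0;
  rewrite scaler0 addr0 scaleN1r addNr.
Qed.

Section DerivedCategory.
Variables (k : fieldType) (Q0 : finType) (Q : quiver Q0).
Notation complex := (complex k Q).
Notation HH := (HH k Q).
Notation Db := (Db k Q).
Notation phi := (phi k Q).
Implicit Types V W X Y Z : complex.

Lemma dmap_split A B E (f : chmap B E) (g : chmap E A) :
  degreewise_split f g -> exact_at (dmap f : @mor k Db _ _) (dmap g).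
Proof.
move=> fg V x gx0; have [th thK phiK] := phi_bij (V : complex) B.
have phi_inj := bij_inj (phi_bij (V : complex) E).
have [|y yE] := hmap_split_exact fg (x := fmor phi x).
  have := congr1 (fun z => fmor phi z) gx0.
  by rewrite fmor_comp phi_dmap fmor0.
by exists (th y); apply: phi_inj; rewrite fmor_comp phi_dmap phiK.
Qed.

Lemma shift_dmap n X Y (f : chmap X Y) :
  fmor (shift_functor k Q n) (dmap f) = dmap (shift_chmap n f).
Proof. exact: (ext_morE (@shift_gen_rel k Q0 Q n) (emap f)). Qed.

Lemma dmap_shift_id n X (f : chmap X X) : (forall i a, f i a = 1%:M) ->
  dmap (shift_chmap n f) = idm (cshift n X : Db).
Proof. by move=> fE; apply: dmap_id => i a; exact: fE. Qed.

Lemma dmap_shift_comp n X Y Z (g : chmap Y Z) (f : chmap X Y) (h : chmap X Z) :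
  (forall i a, h i a = f i a *m g i a) ->
  dmap (shift_chmap n h) = dmap (shift_chmap n g) ∘ dmap (shift_chmap n f).
Proof. by move=> hE; apply: dmap_comp => i a; exact: hE. Qed.

Lemma dmap_shift_lin n X Y c (f g h : chmap X Y) :
  (forall i a, h i a = c *: f i a + g i a) ->
  dmap (shift_chmap n h) = c *: dmap (shift_chmap n f) + dmap (shift_chmap n g).
Proof. by move=> hE; apply: dmap_lin => i a; exact: hE. Qed.

Lemma dmap_shift_cyl n X Y (f : chmap X Y) :
  dmap (shift_chmap n (cyl_top (coh_of f))) =
  dmap (shift_chmap n (cyl_bot (coh_of f))) ∘ dmap (shift_chmap n f).
Proof. by rewrite -!shift_dmap dmap_cyl fmor_comp. Qed.

Lemma dmap_shift_split n A B E (f : chmap B E) (g : chmap E A) :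
  degreewise_split f g ->
  exact_at (dmap (shift_chmap n f) : @mor k Db _ _) (dmap (shift_chmap n g)).
Proof. by move=> fg; exact/dmap_split/degreewise_split_shift. Qed.

Lemma dmap0 X Y (f : chmap X Y) :
  (forall i a, f i a = 0) -> dmap f = 0 :> @mor k Db X Y.
Proof.
move=> f0; transitivity (-1 *: dmap f + dmap f); last by rewrite scaleN1r addNr.
by apply: dmap_lin => i a; rewrite f0 scaler0 addr0.
Qed.

Lemma dmap_null X Y (f : chmap X Y)
    (s : forall i j a, 'M[k]_(X i a, Y j a)) :
  (forall i j l, j = i + 1 -> l = j + 1 -> forall a,
     f j a = boundary_f s i j l a) ->
  (forall i j e, i = j + 1 ->
     rmap (X i) e *m s i j (tgt e) = s i j (src e) *m rmap (Y j) e) ->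
  dmap f = 0 :> @mor k Db X Y.
Proof.
move=> sE sr.
have z0 : theta (coh_zero X Y) = 0.
  by rewrite -thetaqE cls0 lin_fun0//; exact: thetaq_linear.
rewrite -theta_coh_of -z0; apply: theta_homotopic.
exists s, (fun _ _ _ => 0); split=> [i j l ji lj a|u i j l iu ji lj e].
  by rewrite subr0; exact: sE.
by rewrite /boundary_h sr//= !subrr; mxclean.
Qed.

Section ConeRelations.
Variables (X Y : complex) (f : chmap X Y) (n : int).

Lemma cone_in_f :
  dmap (shift_chmap n (cone_in f)) ∘ dmap (shift_chmap n f) = 0
  :> @mor k Db _ _.
Proof.
rewrite (@dmap_shift_comp n _ _ _ (cyl_cone f) (cyl_bot (coh_of f))).
  2: by move=> i a; rewrite cyl_bot_cone.
rewrite -comp_assoc -dmap_shift_cyl.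
rewrite -(dmap_shift_comp _ (h := chmap_comp (cyl_cone f) (cyl_top (coh_of f))))//.
by apply: dmap0 => i a /=; rewrite /cyl_cone_mx mul_row_col; mxclean.
Qed.

Lemma cone_out_in :
  dmap (shift_chmap n (cone_out f)) ∘ dmap (shift_chmap n (cone_in f)) = 0
  :> @mor k Db _ _.
Proof.
rewrite -(dmap_shift_comp _ (h := chmap_comp (cone_out f) (cone_in f)))//.
by apply: dmap0 => i a /=; rewrite mul_row_col; mxclean.
Qed.

(** The null-homotopy is the projection of the cone to [Y]. *)
Lemma cone_shift_out :
  dmap (shift_chmap n (shift_chmap 1 f)) ∘ dmap (shift_chmap n (cone_out f)) = 0
  :> @mor k Db _ _.
Proof.
rewrite -(dmap_shift_comp _ (h := chmap_comp (shift_chmap 1 f) (cone_out f)))//.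
rewrite -shift_dmap; set g := chmap_comp _ _.
suff -> : dmap g = (0 : @mor k Db (cone f) (cshift 1 Y)).
  exact: (fmor0 (shift_functor k Q n) (cone f : Db) (cshift 1 Y)).
apply: (dmap_null (s := fun i j a => col_mx 0 (deg_id Y i (j + 1) a) :
   'M_(cone f i a, cshift 1 Y j a))) => [i j l -> -> a|i j e ->].
  rewrite /boundary_f cshift1_cd [X in _ = X + _]mul_block_col !deg_id1.
  rewrite [LHS]mul_col_mx mul_col_mx; mxclean.
  by rewrite add_col_mx subrr; mxclean.
rewrite [LHS]mul_block_col [RHS]mul_col_mx !deg_id1; mxclean.
by [].
Qed.

End ConeRelations.

Lemma findim_mor (V X : Db) : findim (mor V X).
Proof.
have [N V0] := cx_bounded V.
pose deg (m : 'I_(N + N).+1) : int := m%:Z - N%:Z.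
have degP i : (`|i| <= N)%N -> exists m, i = deg m.
  move=> iN; have lt : (absz (i + N%:Z)%R < (N + N).+1)%N by lia.
  by exists (Ordinal lt); rewrite /deg /=; lia.
pose I1 := {x : 'I_(N + N).+1 * Q0 &
  ('I_((V : complex) (deg x.1) x.2) * 'I_((X : complex) (deg x.1) x.2))%type}.
pose I2 := {x : 'I_(N + N).+1 * arrow Q &
  ('I_((V : complex) (deg x.1) (src x.2)) *
   'I_((X : complex) (deg x.1 - 1)%R (tgt x.2)))%type}.
pose ev (x : I1 + I2) (p : coh V X) : k :=
  match x with
  | inl y => coh_f p (deg (tag y).1) (tag y).2 (tagged y).1 (tagged y).2
  | inr y => coh_h p (deg (tag y).1) (deg (tag y).1 - 1) (tag y).2
               (tagged y).1 (tagged y).2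
  end.
apply: (@findim_separated k (mor V X) (coh V X) _ (@theta k Q0 Q V X) ev).
- by move=> x; exists (repr (fmor phi x : hhom V X)); exact: thetaqK.
- move=> c p q; exists (coh_comb c 1 p q); rewrite theta_linear; split=> //.
  by case=> y /=; rewrite !mxE mul1r.
move=> p p0; transitivity (theta (coh_zero V X)); last first.
  by rewrite -thetaqE cls0 lin_fun0//; exact: thetaq_linear.
apply/theta_homotopic/coh_eq_homotopic; split=> [i a|i j e ij].
  apply/matrixP => r c; rewrite mxE; have [/degP[m mE]|iN] := leqP `|i| N.
    subst i; exact: (p0 (inl (Tagged (fun x : 'I_(N + N).+1 * Q0 =>
      ('I_((V : complex) (deg x.1) x.2) * 'I_((X : complex) (deg x.1) x.2))%type)
      (i := (m, a)) (r, c)))).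
  by have := ltn_ord r; rewrite [X in (_ < X)%N](V0 i iN).
have ji : j = i - 1 by rewrite ij addrK.
clear ij.
apply/matrixP => r c; rewrite mxE; have [/degP[m mE]|iN] := leqP `|i| N.
  subst j; subst i; exact: (p0 (inr (Tagged (fun x : 'I_(N + N).+1 * arrow Q =>
    ('I_((V : complex) (deg x.1) (src x.2)) *
     'I_((X : complex) (deg x.1 - 1)%R (tgt x.2)))%type)
    (i := (m, e)) (r, c)))).
by have := ltn_ord r; rewrite [X in (_ < X)%N](V0 i iN).
Qed.

Lemma hdim_vanish (V X : Db) : exists N : nat, forall n : int, (N < `|n|)%N ->
  hdim V X n = 0%N.
Proof.
have [N V0] := cx_bounded V; have [M X0] := cx_bounded X.
exists (N + M + 1)%N => n nNM.
have mor0 (x : mor V (cshift n X : Db)) : x = 0.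
  rewrite -[x]thetaqK -[fmor phi x]clsK; move: (repr _) => p.
  transitivity (theta (coh_zero V (cshift n X))); last first.
    by rewrite -thetaqE cls0 lin_fun0//; exact: thetaq_linear.
  rewrite thetaqE; apply/theta_homotopic/coh_eq_homotopic.
  split=> [i a|i j e ij]; apply/matrixP => r c; rewrite mxE; exfalso.
    have [iN|iN] := leqP `|i| N; last first.
      by have := ltn_ord r; rewrite [X in (_ < X)%N](V0 i iN).
    have jM : (M < absz (i + n)%R)%N by lia.
    by have := ltn_ord c; rewrite [X in (_ < X)%N](X0 _ jM).
  have [iN|iN] := leqP `|i| N; last first.
    by have := ltn_ord r; rewrite [X in (_ < X)%N](V0 i iN).
  have jM : (M < absz (j + n)%R)%N by lia.
  by have := ltn_ord c; rewrite [X in (_ < X)%N](X0 _ jM).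
apply: sdim_hasdim; apply/hasdimP; exists (fun _ => 0); split.
- by move=> c x y; rewrite scaler0 addr0.
- by move=> x y _; apply/rowP; case.
- by apply/seteqP; split=> // x _; exists 0; rewrite // mor0.
Qed.

End DerivedCategory.

Section HomRanks.
Variables (k : fieldType) (C : lincat k).
Hypothesis findimC : forall X Y : C, findim (mor X Y).
Implicit Types V X Y Z : C.

Lemma comp_linear V X Y (f : mor X Y) : linear (fun x : mor V X => f ∘ x).
Proof. by move=> c x y; exact: comp_linr. Qed.

Lemma comp_bij V X Y (f : mor X Y) : is_iso f ->
  bijective (fun x : mor V X => f ∘ x).
Proof.
by move=> [g [gf fg]]; exists (fun x => g ∘ x) => x;
  rewrite comp_assoc ?gf ?fg comp_idl.
Qed.

Lemma ldim_iso V X Y (f : mor X Y) : is_iso f ->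
  ldim (mor V X) = ldim (mor V Y).
Proof.
by move=> fi; exact: (ldim_bij (findimC V X) (comp_linear f) (comp_bij V fi)).
Qed.

Lemma rk_iso V X Y X' Y' (f : mor X Y) (f' : mor X' Y') (a : mor X X')
    (b : mor Y Y') : is_iso a -> is_iso b -> f' ∘ a = b ∘ f ->
  rk (fun x : mor V X' => f' ∘ x) = rk (fun x : mor V X => f ∘ x).
Proof.
move=> ai bi comm; have [a' aK a'K] := comp_bij V ai.
apply: (rk_conj (a := fun x => a ∘ x) (b := fun y => b ∘ y) (findimC V X));
  try exact: comp_linear.
- by move=> y; exists (a' y).
- exact/bij_inj/comp_bij.
by move=> x; rewrite !comp_assoc comm.
Qed.

Lemma rk_exact V X Y Z (f : mor X Y) (g : mor Y Z) :
  exact_at f g -> g ∘ f = 0 ->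
  ldim (mor V Y) = (rk (fun x : mor V X => f ∘ x) +
                    rk (fun y : mor V Y => g ∘ y))%N.
Proof.
move=> fg gf; rewrite (rank_nullity (findimC V Y) (comp_linear g)) addnC.
congr (_ + _)%N; rewrite /rk; congr sdim; apply/seteqP; split=> y /=.
  by move=> /fg[x ->]; exists x.
by move=> [x _ <-]; rewrite comp_assoc gf comp_linl0.
Qed.

Lemma rk_leq V X Y (f : mor X Y) :
  (rk (fun x : mor V X => f ∘ x) <= ldim (mor V X))%N.
Proof. by rewrite (rank_nullity (findimC V X) (comp_linear f)) leq_addr. Qed.

Lemma rk_mono V X Y (f : mor X Y) (g : mor Y X) : g ∘ f = idm X ->
  rk (fun x : mor V X => f ∘ x) = ldim (mor V X).
Proof.
move=> gf; rewrite (rank_nullity (findimC V X) (comp_linear f)).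
rewrite [X in (_ + X)%N](_ : _ = 0%N) ?addn0//.
apply: sdim_hasdim; apply/hasdimP; exists (fun _ => 0); split.
- by move=> c x y; rewrite scaler0 addr0.
- by move=> x y _; apply/rowP; case.
apply/seteqP; split=> x /=; last by move=> [_ _ <-]; rewrite comp_linr0.
move=> fx0; exists 0 => //.
by rewrite -[x]comp_idl -gf -comp_assoc fx0 comp_linr0.
Qed.

Lemma rk_epi V X Y (f : mor X Y) (g : mor Y X) : f ∘ g = idm Y ->
  rk (fun x : mor V X => f ∘ x) = ldim (mor V Y).
Proof.
move=> fg; rewrite /rk /ldim; congr sdim; apply/seteqP; split=> // y _.
by exists (g ∘ y) => //; rewrite comp_assoc fg comp_idl.
Qed.

End HomRanks.

(** * Euler characteristics *)

Section IntegerSums.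
Local Open Scope classical_set_scope.
Implicit Types F G : int -> int.

Lemma fsum_nonpos F N : (forall m, (N <= m)%N -> F (- m%:Z) = 0) ->
  \sum_(i \in [set i : int | i <= 0]) F i = \sum_(m < N) F (- m%:Z).
Proof.
move=> F0; rewrite (fsbig_ord _ _ (fun m => F (- m%:Z))).
have inj : set_inj `I_N (fun m : nat => - m%:Z).
  by move=> m n _ _ /= /oppr_inj[].
rewrite -(fsbig_image `I_N (fun m : nat => - m%:Z) F inj).
apply/esym/fsbig_widen => [_ [m _ <-]|i [/= i0 iN]] /=; first by lia.
rewrite (_ : i = - (absz i)%:Z); last by lia.
apply: F0; rewrite leqNgt; apply/negP => mN; apply: iN.
by exists (absz i) => //; lia.
Qed.

Lemma fsum_bounded F N : (forall i, (N < `|i|)%N -> F i = 0) ->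
  \sum_(i \in [set: int]) F i = \sum_(m < (N + N).+1) F (m%:Z - N%:Z).
Proof.
move=> F0; rewrite (fsbig_ord _ _ (fun m => F (m%:Z - N%:Z))).
have inj : set_inj `I_(N + N).+1 (fun m : nat => m%:Z - N%:Z).
  by move=> m n _ _ /= /addIr[].
rewrite -(fsbig_image `I_(N + N).+1 (fun m : nat => m%:Z - N%:Z) F inj).
apply/esym/fsbig_widen => [//|i [_ /= iN]]; apply: F0.
rewrite ltnNge; apply/negP => iN'; apply: iN.
exists (absz (i + N%:Z)) => /=; lia.
Qed.

Definition bounded_support F := exists N, forall i, (N < `|i|)%N -> F i = 0.

Lemma fsum_add F G : bounded_support F -> bounded_support G ->
  \sum_(i \in [set: int]) (F i + G i) =
  \sum_(i \in [set: int]) F i + \sum_(i \in [set: int]) G i.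
Proof.
move=> [N FN] [M GM].
rewrite !(@fsum_bounded _ (N + M)%N) ?big_split// => i iNM.
- by apply: GM; lia.
- by apply: FN; lia.
- by rewrite FN ?GM//; lia.
Qed.

Lemma fsum_shift F :
  \sum_(i \in [set: int]) F (i + 1) = \sum_(i \in [set: int]) F i.
Proof.
rewrite [RHS](reindex_fsbigT (fun i => i + 1)) //.
by exists (fun i => i - 1) => i; rewrite ?addrK ?subrK.
Qed.

Lemma fsum_opp F :
  \sum_(i \in [set: int]) - F i = - \sum_(i \in [set: int]) F i.
Proof.
rewrite -mulN1r mulr_fsumr; apply: eq_fsbigr => i _.
by rewrite mulN1r.
Qed.

Lemma signz_succ (i : int) : (-1 : int) ^ (i + 1) = - (-1) ^ i.
Proof. by rewrite exprzDr ?unitrN1// expr1z mulrN1. Qed.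

Lemma signz_opp (m : nat) : (-1 : int) ^ (- m%:Z) = (-1) ^+ m.
Proof. by rewrite -exprz_inv invrN1. Qed.

Lemma telescope_signed (r : int -> int) K :
  \sum_(m < K) (-1) ^+ m * (r (- m%:Z) + r (- m%:Z - 1)) =
  r 0 - (-1) ^+ K * r (- K%:Z).
Proof.
elim: K => [|K IH]; first by rewrite big_ord0 expr0 mul1r oppr0 subrr.
rewrite big_ord_recr /= IH exprS.
rewrite (_ : - K%:Z - 1 = - K.+1%:Z); last by lia.
ring.
Qed.

End IntegerSums.

Section EulerCharacteristic.
Variables (k : fieldType) (Q0 : finType) (Q : quiver Q0).
Notation complex := (complex k Q).
Notation Db := (Db k Q).
Implicit Types V W X Y Z : complex.

Lemma coh_homology_leq X Y (p : coh X Y) (q : coh Y X) :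
  homotopic (coh_comp q p) (coh_of (chmap_id X)) ->
  forall h i j, i = h + 1 -> j = i + 1 -> forall a,
  (X i a + \rank (cd Y i j a) + \rank (cd Y h i a) <=
   Y i a + \rank (cd X i j a) + \rank (cd X h i a))%N.
Proof.
move=> [s [_ [sE _]]] h i j ih ji a.
set f := coh_f p i a; set M := f *m cokermx (cd Y h i a).
have kerX : (kermx (cd X i j a) :&: kermx M <= cd X h i a)%MS.
  apply/row_subP => r; set x := row r _.
  have : (x <= kermx (cd X i j a) :&: kermx M)%MS by exact: row_sub.
  rewrite sub_capmx => /andP[/sub_kermxP xd /sub_kermxP].
  rewrite /M mulmxA => /eqP; rewrite -submxE => /submxP[y yE].
  have := sE h i j ih ji a => /(congr1 (mulmx x)).
  rewrite /boundary_f /= mulmxBr mulmxDr !mulmxA xd mul0mx add0r mulmx1 -/f yE.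
  rewrite -[_ *m coh_f q i a]mulmxA -coh_chain mulmxA => /eqP.
  rewrite subr_eq addrC -subr_eq => /eqP <-; rewrite -mulmxBl.
  exact: submxMl.
have kerY : (kermx (cd X i j a) *m f <= kermx (cd Y i j a))%MS.
  apply/sub_kermxP; rewrite -mulmxA coh_chain mulmxA.
  by rewrite mulmx_ker mul0mx.
have imY :
    (cd Y h i a <= kermx (cd Y i j a) :&: kermx (cokermx (cd Y h i a)))%MS.
  rewrite sub_capmx; apply/andP; split; apply/sub_kermxP; first exact: cdd.
  exact: mulmx_coker.
have := mxrank_mul_ker (kermx (cd X i j a)) M.
have := mxrank_mul_ker (kermx (cd Y i j a)) (cokermx (cd Y h i a)).
have := mxrankS kerX; have := mxrankS imY.
have : (\rank (kermx (cd X i j a) *m M) <=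
    \rank (kermx (cd Y i j a) *m cokermx (cd Y h i a)))%N.
  by rewrite /M mulmxA; apply/mxrankS/submxMr.
rewrite !mxrank_ker.
have := rank_leq_row (cd X i j a); have := rank_leq_row (cd Y i j a).
lia.
Qed.

Definition homology_dim X (i : int) a : int :=
  (X i a)%:Z - (\rank (cd X i (i + 1) a))%:Z - (\rank (cd X (i - 1) i a))%:Z.

Lemma dimvec_homology X a : dimvec X a =
  \sum_(i \in [set: int]%classic) (-1) ^ i * homology_dim X i a.
Proof.
have [N X0] := cx_bounded X.
pose d i := (-1) ^ i * (\rank (cd X i (i + 1) a))%:Z.
have d0 : bounded_support d.
  exists N => i iN; rewrite /d.
  have := rank_leq_row (cd X i (i + 1) a).
  by rewrite [X in (_ <= X)%N](X0 i iN) leqn0 => /eqP ->; rewrite mulr0.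
have d'0 : bounded_support (fun i => d (i - 1)).
  by have [M dM] := d0; exists M.+1 => i iM; apply: dM; lia.
have dd'0 : bounded_support (fun i => - d i + d (i - 1)).
  have [M dM] := d0; exists M.+1 => i iM.
  by rewrite !dM ?oppr0 ?addr0//; lia.
have Xb : bounded_support (fun i => (-1) ^ i * (X i a)%:Z).
  by exists N => i iN; rewrite X0// mulr0.
transitivity (\sum_(i \in [set: int]%classic)
    ((-1) ^ i * (X i a)%:Z + (- d i + d (i - 1)))).
  rewrite fsum_add// fsum_add//; last first.
    by have [M dM] := d0; exists M => i /dM ->; rewrite oppr0.
  rewrite fsum_opp -(fsum_shift (fun i => d (i - 1))).
  rewrite [X in _ + (_ + X)](_ : _ = \sum_(i \in [set: int]%classic) d i).
    by rewrite addNr addr0.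
  by apply: eq_fsbigr => i _; rewrite addrK.
apply: eq_fsbigr => i _; rewrite /d /homology_dim.
have := signz_succ (i - 1); rewrite subrK => ->.
by ring.
Qed.

Lemma dimvec_iso (X Y : Db) : isomorphic X Y -> dimvec X = dimvec Y.
Proof.
move=> [f [g [gf fg]]]; apply/funext => a; rewrite !dimvec_homology.
apply: eq_fsbigr => i _; congr (_ * _).
have inv (U W : Db) (x : mor U W) (y : mor W U) : y ∘ x = idm U ->
    homotopic (coh_comp (repr (fmor (phi k Q) y : hhom W U))
                        (repr (fmor (phi k Q) x : hhom U W)))
              (coh_of (chmap_id U)).
  move=> yx; apply/clsP; rewrite -hcompE !clsK.
  have := fmor_comp (phi k Q) y x; rewrite yx fmor_id => h.
  exact: (esym h).
have := coh_homology_leq (inv _ _ _ _ gf) (esym (subrK 1 i)) erefl a.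
have := coh_homology_leq (inv _ _ _ _ fg) (esym (subrK 1 i)) erefl a.
rewrite /homology_dim.
do 4!move: (\rank _) => ?.
by move: (rdim (cx X i) a) (rdim (cx Y i) a) => *; lia.
Qed.

Lemma bounded_dims X a : bounded_support (fun i => (-1) ^ i * (X i a)%:Z).
Proof. by have [N X0] := cx_bounded X; exists N => i iN; rewrite X0// mulr0. Qed.

Lemma bounded_dims_shift X a :
  bounded_support (fun i => (-1) ^ i * (X (i + 1) a)%:Z).
Proof.
have [N X0] := cx_bounded X; exists N.+1 => i iN; rewrite X0 ?mulr0//; lia.
Qed.

Lemma dimvec_cone X Y (f : chmap X Y) a :
  dimvec (cone f : Db) a = dimvec (Y : Db) a - dimvec (X : Db) a.
Proof.
rewrite /dimvec -[X in _ - X]fsum_shift -fsum_opp addrC -fsum_add; last first.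
- exact: bounded_dims.
- have [N XN] := bounded_dims_shift X a; exists N => i /XN.
  by rewrite signz_succ mulNr opprK.
apply: eq_fsbigr => i _ /=; rewrite signz_succ PoszD mulNr opprK mulrDr.
by [].
Qed.

Lemma dimvec_dsum X Y a :
  dimvec (dsum X Y) a = dimvec (X : Db) a + dimvec (Y : Db) a.
Proof.
rewrite /dimvec -fsum_add; [|exact: bounded_dims..].
by apply: eq_fsbigr => i _ /=; rewrite PoszD mulrDr.
Qed.

End EulerCharacteristic.

(** * The long exact sequence of a cone *)

Section LongExactSequence.
Variables (k : fieldType) (Q0 : finType) (Q : quiver Q0).
Notation complex := (complex k Q).
Notation Db := (Db k Q).
Implicit Types X Y Z : complex.

Section DirectSum.
Variables X Y : complex.

Fact dsum_inl_rhP i e : rmap (X i) e *m row_mx 1%:M 0 =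
  row_mx 1%:M 0 *m rmap ((dsum X Y : complex) i) e.
Proof. by rewrite [RHS]mul_row_block mul_mx_row; mxclean. Qed.

Fact dsum_inl_chP i j a : row_mx 1%:M 0 *m cd (dsum X Y : complex) i j a =
  cd X i j a *m row_mx 1%:M 0.
Proof. by rewrite [LHS]mul_row_block mul_mx_row; mxclean. Qed.

Definition dsum_inl : chmap X (dsum X Y) := @ChMap _ _ _ X (dsum X Y)
  (fun i => @RHom _ _ _ (X i) ((dsum X Y : complex) i)
     (fun a => row_mx 1%:M 0) (dsum_inl_rhP i)) dsum_inl_chP.

Fact dsum_inr_rhP i e : rmap (Y i) e *m row_mx 0 1%:M =
  row_mx 0 1%:M *m rmap ((dsum X Y : complex) i) e.
Proof. by rewrite [RHS]mul_row_block mul_mx_row; mxclean. Qed.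

Fact dsum_inr_chP i j a : row_mx 0 1%:M *m cd (dsum X Y : complex) i j a =
  cd Y i j a *m row_mx 0 1%:M.
Proof. by rewrite [LHS]mul_row_block mul_mx_row; mxclean. Qed.

Definition dsum_inr : chmap Y (dsum X Y) := @ChMap _ _ _ Y (dsum X Y)
  (fun i => @RHom _ _ _ (Y i) ((dsum X Y : complex) i)
     (fun a => row_mx 0 1%:M) (dsum_inr_rhP i)) dsum_inr_chP.

Fact dsum_fst_rhP i e : rmap ((dsum X Y : complex) i) e *m col_mx 1%:M 0 =
  col_mx 1%:M 0 *m rmap (X i) e.
Proof. by rewrite [LHS]mul_block_col mul_col_mx; mxclean. Qed.

Fact dsum_fst_chP i j a : col_mx 1%:M 0 *m cd X i j a =
  cd (dsum X Y : complex) i j a *m col_mx 1%:M 0.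
Proof. by rewrite [RHS]mul_block_col mul_col_mx; mxclean. Qed.

Definition dsum_fst : chmap (dsum X Y) X := @ChMap _ _ _ (dsum X Y) X
  (fun i => @RHom _ _ _ ((dsum X Y : complex) i) (X i)
     (fun a => col_mx 1%:M 0) (dsum_fst_rhP i)) dsum_fst_chP.

Fact dsum_snd_rhP i e : rmap ((dsum X Y : complex) i) e *m col_mx 0 1%:M =
  col_mx 0 1%:M *m rmap (Y i) e.
Proof. by rewrite [LHS]mul_block_col mul_col_mx; mxclean. Qed.

Fact dsum_snd_chP i j a : col_mx 0 1%:M *m cd Y i j a =
  cd (dsum X Y : complex) i j a *m col_mx 0 1%:M.
Proof. by rewrite [RHS]mul_block_col mul_col_mx; mxclean. Qed.

Definition dsum_snd : chmap (dsum X Y) Y := @ChMap _ _ _ (dsum X Y) Y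
  (fun i => @RHom _ _ _ ((dsum X Y : complex) i) (Y i)
     (fun a => col_mx 0 1%:M) (dsum_snd_rhP i)) dsum_snd_chP.

Lemma dsum_split : degreewise_split dsum_inl dsum_snd.
Proof.
exists (fun n a => dsum_fst n a), (fun n a => dsum_inr n a).
split=> [n e|n e|n a|n a|n a].
- exact: dsum_fst_rhP.
- exact: dsum_inr_rhP.
- by rewrite /= mul_row_col; mxclean.
- by rewrite /= mul_row_col; mxclean.
- rewrite /= !mul_col_mx; mxclean; rewrite add_col_mx; mxclean.
  by rewrite -block_mxEv -scalar_mx_block.
Qed.

Lemma hdim_dsum (V : Db) n : hdim V (dsum X Y) n = (hdim V X n + hdim V Y n)%N.
Proof.
rewrite /hdim.
rewrite (rk_exact (@findim_mor k Q0 Q) V (dmap_shift_split (n := n) dsum_split)).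
  congr (_ + _)%N.
    apply: (rk_mono (@findim_mor k Q0 Q) V (g := dmap (shift_chmap n dsum_fst))).
    rewrite -(dmap_shift_comp _ (h := chmap_id X)) ?dmap_shift_id// => i a.
    by rewrite /= mul_row_col; mxclean.
  apply: (rk_epi V (g := dmap (shift_chmap n dsum_inr))).
  rewrite -(dmap_shift_comp _ (h := chmap_id Y)) ?dmap_shift_id// => i a.
  by rewrite /= mul_row_col; mxclean.
rewrite -(dmap_shift_comp _ (h := chmap_comp dsum_snd dsum_inl))//.
by apply: dmap0 => i a /=; rewrite mul_row_col; mxclean.
Qed.

End DirectSum.

Section ConeDimensions.
Variables (V : Db) (X Y : complex) (f : chmap X Y).

Definition connecting_rank (n : int) : nat :=
  rk (fun x : mor V (cshift n (cone f) : Db) =>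
        dmap (shift_chmap n (cone_out f)) ∘ x).

Lemma hdim_cone (n : int) :
  (hdim V X n + hdim V (cone f) n)%N =
  (hdim V Y n + connecting_rank n + connecting_rank (n - 1))%N.
Proof.
have dimY : hdim V Y n = _ := rk_exact (@findim_mor k Q0 Q) V
  (exact_cone_in (@dmap_shift_id k Q0 Q n) (@dmap_shift_comp k Q0 Q n)
     (@dmap_shift_cyl k Q0 Q n) (@dmap_shift_split k Q0 Q n) (f := f))
  (cone_in_f f n).
have dimC : hdim V (cone f) n = _ := rk_exact (@findim_mor k Q0 Q) V
  (exact_cone_out (@dmap_shift_split k Q0 Q n) (f := f)) (cone_out_in f n).
have dimX1 := rk_exact (@findim_mor k Q0 Q) V
  (exact_cone_shift (@dmap_shift_id k Q0 Q (n - 1))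
     (@dmap_shift_comp k Q0 Q (n - 1)) (@dmap_shift_lin k Q0 Q (n - 1))
     (@dmap_shift_split k Q0 Q (n - 1)) (f := f)) (cone_shift_out f (n - 1)).
have nE : n = n - 1 + 1 by rewrite subrK.
have mergeX := shift_merge_iso (@dmap_id k Q0 Q) (@dmap_comp k Q0 Q) nE X.
have mergeY := shift_merge_iso (@dmap_id k Q0 Q) (@dmap_comp k Q0 Q) nE Y.
have dimX : hdim V X n = _ := esym (ldim_iso (@findim_mor k Q0 Q) V mergeX).
have rkf := rk_iso (@findim_mor k Q0 Q) V mergeX mergeY
  (shift_merge_natural (@dmap_comp k Q0 Q) nE f).
rewrite dimY dimC dimX dimX1 /connecting_rank -rkf.
lia.
Qed.

Lemma connecting_rank_vanish : exists N : nat, forall n : int,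
  (N < `|n|)%N -> connecting_rank n = 0%N.
Proof.
have [N V0] := hdim_vanish V (cone f); exists N => n /V0 n0.
have := rk_leq (@findim_mor k Q0 Q) V (dmap (shift_chmap n (cone_out f))).
by rewrite -[ldim _]/(hdim V (cone f) n) n0 leqn0 => /eqP.
Qed.

Lemma half_eulerE (Z : Db) : exists N, forall K, (N <= K)%N ->
  half_euler V Z = \sum_(m < K) (-1) ^+ m * (hdim V Z (- m%:Z))%:Z.
Proof.
have [N V0] := hdim_vanish V Z; exists N.+1 => K NK.
rewrite /half_euler (@fsum_nonpos _ K) => [|m Km].
  by apply: eq_bigr => m _; rewrite signz_opp.
by rewrite V0 ?mulr0//; lia.
Qed.

Lemma half_euler_cone :
  half_euler V X - half_euler V Y + half_euler V (cone f) =
  (connecting_rank 0)%:Z.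
Proof.
have [N1 E1] := half_eulerE X; have [N2 E2] := half_eulerE Y.
have [N3 E3] := half_eulerE (cone f); have [N4 E4] := connecting_rank_vanish.
pose K := (N1 + N2 + N3 + N4).+1.
rewrite (E1 K) ?(E2 K) ?(E3 K); try by rewrite /K; lia.
rewrite -sumrB -big_split /=.
transitivity (\sum_(m < K) (-1) ^+ m *
    ((connecting_rank (- m%:Z))%:Z + (connecting_rank (- m%:Z - 1))%:Z)).
  apply: eq_bigr => m _; have := hdim_cone (- m%:Z) => /(congr1 Posz).
  rewrite !PoszD -mulrBr -mulrDr => h; congr (_ * _).
  by rewrite addrAC h; ring.
rewrite (telescope_signed (fun n => (connecting_rank n)%:Z)).
rewrite (E4 (- K%:Z)) ?mulr0 ?subr0//.
by rewrite /K; lia.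
Qed.

Lemma half_euler_dsum :
  half_euler V (dsum X Y) = half_euler V X + half_euler V Y.
Proof.
have [N1 E1] := half_eulerE X; have [N2 E2] := half_eulerE Y.
have [N3 E3] := half_eulerE (dsum X Y).
pose K := (N1 + N2 + N3)%N.
rewrite (E1 K) ?(E2 K) ?(E3 K); try by rewrite /K; lia.
rewrite -big_split /=; apply: eq_bigr => m _.
by rewrite hdim_dsum PoszD mulrDr.
Qed.

End ConeDimensions.

Lemma is_iso_shift n (X Y : Db) (f : mor X Y) : is_iso f ->
  is_iso (fmor (shift_functor k Q n) f).
Proof.
move=> [g [gf fg]]; exists (fmor (shift_functor k Q n) g).
by rewrite -!fmor_comp gf fg !fmor_id.
Qed.

Lemma half_euler_iso (V X Y : Db) (f : mor X Y) : is_iso f ->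
  half_euler V X = half_euler V Y.
Proof.
move=> fi; rewrite /half_euler; apply: eq_fsbigr => n _; congr (_ * _%:Z).
exact: (ldim_iso (@findim_mor k Q0 Q) V (is_iso_shift n fi)).
Qed.

End LongExactSequence.

Theorem corollary2p12 (k : closedFieldType)
    (D0 : finType) (adj : rel D0) (adj_dynkin : is_dynkin adj)
    (Q : quiver D0) (Q_adj : has_underlying_graph Q adj)
    (x0 : D0) (v : ar_identification k adj x0 Q)
    (A B C : Db k Q) (u : mor A B) (w : mor B C)
    (g : @mor k (Db k Q) C (cshift 1%R A)) (sigma : distinguished u w g) :
  exists dimE : dimvec B = dimvec (dsum A C),
    delta_triangle v sigma = delta_pair v dimE.
Proof.
have [X [Y [f [a [b [c [[ai bi ci] [_ _ gout]]]]]]]] := sigma.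
have dimE : dimvec B = dimvec (dsum A C).
  apply/funext => x; rewrite dimvec_dsum.
  rewrite (dimvec_iso (ex_intro _ a ai)) (dimvec_iso (ex_intro _ b bi)).
  by rewrite (dimvec_iso (ex_intro _ c ci)) dimvec_cone addrC subrK.
exists dimE; apply/funext => m; rewrite /delta_triangle /delta_pair.
set V := ar_functor v (mesh_tgt m).
rewrite half_euler_dsum (half_euler_iso V ai) (half_euler_iso V bi).
rewrite (half_euler_iso V ci) addrAC half_euler_cone; congr _%:Z.
rewrite -(rk_iso (@findim_mor k D0 Q) V ci (is_iso_shift 1 ai) (esym gout)).
have unX : is_iso (dmap (unshift (cshift 1 X))).
  exact: unshift_iso (@dmap_id k D0 Q) (@dmap_comp k D0 Q) _.
have unC : is_iso (dmap (unshift (cone f))).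
  exact: unshift_iso (@dmap_id k D0 Q) (@dmap_comp k D0 Q) _.
exact: (rk_iso (@findim_mor k D0 Q) V unC unX
  (unshift_natural (@dmap_comp k D0 Q) (cone_out f))).
Qed.
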